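(* Suppose $a=\{a_j\}_{j\ge1}$ is a positive, decreasing, summable, doubling sequence. Then $$\{\dim_A E: E\in\mathcal{C}_a\}=[\dim_A C_a,1].$$
   Context: Decreasing means $a_j\ge a_{j+1}$ for all $j$. A decreasing sequence $\{a_n\}$ is doubling if there is a constant $\tau$ such that $a_n\le\tau a_{2n}$ for all $n$. Let $L=\sum_j a_j$. The family $\mathcal{C}_a$ of complementary sets of $a$ consists of the closed subsets $E$ of $[0,L]$ of the form $E=[0,L]\setminus\bigcup_{j=1}^\infty U_j$, where $\{U_j\}$ is a disjoint family of open intervals contained in $[0,L]$ with the length of $U_j$ equal to $a_j$ for each $j$. The associated Cantor set $C_a\in\mathcal{C}_a$ is constructed as follows. From $I=[0,L]$ remove an open interval of length $a_1$, leaving two closed intervals $I^1_1$ and $I^1_2$ (left to right). Having constructed the closed intervals $I^k_1,\dots,I^k_{2^k}$ of step $k$ (left to right), remove from each $I^k_j$ an open interval of length $a_{2^k+j-1}$, leaving the closed intervals $I^{k+1}_{2j-1}$ and $I^{k+1}_{2j}$. The positions are uniquely determined by requiring that the length of each $I^k_j$ equal the sum of the lengths of all the open intervals subsequently removed from it. Then $C_a=\bigcap_{k\ge1}\bigcup_{j=1}^{2^k}I^k_j$. For non-empty $F\subset\mathbb{R}$, $N_r(F)$ denotes the minimum number of closed balls of radius $r$ needed to cover $F$, and $B(x,R)$ is the closed ball of radius $R$ centred at $x$. The Assouad dimension is $$\dim_A F=\inf\Bigl\{\alpha:\ \exists\, c,\rho>0 \text{ such that } \sup_{x\in F}N_r(B(x,R)\cap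 F)\le c\left(\tfrac{R}{r}\right)^{\alpha}\text{ for all }0<r<R<\rho\Bigr\}.$$ *)

(* Defs.v *)
From HB Require Import structures.
From mathcomp Require Import all_boot all_order all_algebra.
From mathcomp Require Import all_classical all_reals all_analysis.

Set Implicit Arguments.
Unset Strict Implicit.
Unset Printing Implicit Defensive.

Import Order.TTheory GRing.Theory Num.Theory.
Import numFieldNormedType.Exports.

Local Open Scope classical_set_scope.
Local Open Scope ring_scope.

(* Sequences are indexed from 1, as in a_1, a_2, ...: the value a 0 is never
   used. *)

Section ComplementarySets.
Context {R : realType}.
Implicit Types (a : nat -> R) (E F : set R).

Definition positive_terms a := forall j, (0 < j)%N -> 0 < a j.

Definition decreasing_terms a := forall j, (0 < j)%N -> a j.+1 <= a j.

Definition summable_terms a := cvgn (fun n => \sum_(1 <= j < n) a j).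

Definition doubling_terms a :=
  exists tau : R, forall n, (0 < n)%N -> a n <= tau * a (2 * n)%N.

Definition total_length a : R := limn (fun n => \sum_(1 <= j < n) a j).

Definition complementary_set a E :=
  closed E /\
  exists U : nat -> set R,
    [/\ forall j, (0 < j)%N -> exists x : R, U j = `]x, x + a j[%classic,
        forall j, (0 < j)%N -> U j `<=` `[0, total_length a]%classic,
        trivIset [set j | (0 < j)%N] U
      & E = `[0, total_length a]%classic `\` \bigcup_(j in [set j | (0 < j)%N]) U j].

(* The interval I^k_(j+1) (here 0 <= j < 2^k, so that step 0 is the single
   interval [0, L]) loses the gap a_(2^k + j) and is split into I^(k+1)_(2j+1)
   and I^(k+1)_(2j+2).  Its descendants at step k + i are the I^(k+i)_(m+1)
   with 2^i j <= m < 2^i (j + 1), which lose the gaps a_(2^(k+i) + m).  Its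
   length is the sum of all these gaps over i. *)
Definition cantor_length a (k j : nat) : R :=
  limn (fun n =>
    \sum_(0 <= i < n) \sum_(0 <= l < 2 ^ i) a (2 ^ (k + i) + 2 ^ i * j + l)%N).

(* A left child keeps the left endpoint of its parent; a right child starts
   after its left sibling and the gap removed from the parent. *)
Fixpoint cantor_left a (k j : nat) : R :=
  if k is k'.+1 then
    cantor_left a k' j./2 +
    (if odd j then cantor_length a k j.-1 + a (2 ^ k' + j./2)%N else 0)
  else 0.

Definition cantor_interval a (k j : nat) : set R :=
  `[cantor_left a k j, cantor_left a k j + cantor_length a k j]%classic.

Definition cantor_set a : set R :=
  \bigcap_(k in [set k | (0 < k)%N])
    \bigcup_(j in [set j | (j < 2 ^ k)%N]) cantor_interval a k j.

(* An infimum of natural numbers, hence a minimum when a finite cover exists,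
   and +oo otherwise. *)
Definition covering_number (r : R) F : \bar R :=
  ereal_inf [set n%:R%:E | n in [set n : nat |
    exists x : 'I_n -> R, F `<=` \bigcup_(i in [set: 'I_n]) closed_ball (x i) r]].

Definition assouad_exponent F (alpha : R) :=
  exists c rho : R, [/\ 0 < c, 0 < rho &
    forall r S : R, 0 < r -> r < S -> S < rho ->
      (ereal_sup [set covering_number r (closed_ball x S `&` F) | x in F]
        <= (c * (S / r) `^ alpha)%:E)%E].

Definition assouad_dim F : \bar R :=
  ereal_inf [set alpha%:E | alpha in assouad_exponent F].

End ComplementarySets.

(* Main.v *)
Require Import Defs.
From mathcomp Require Import all_boot all_order all_algebra.
From mathcomp Require Import all_classical all_reals all_analysis.
From mathcomp Require Import zify ring lra.
Import Order.TTheory GRing.Theory Num.Theory.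
Import numFieldNormedType.Exports.
Local Open Scope classical_set_scope.
Local Open Scope ring_scope.

Set Implicit Arguments.
Unset Strict Implicit.
Unset Printing Implicit Defensive.

(** Let A_k be the length of the longest interval of step k in the construction
    of the Cantor set C_a. Doubling makes all intervals of step k comparable to
    A_k, and A_k comparable to A_(k+1). Everything rests on the condition
      2^n <= C (A_k / A_(k+n))^alpha    for all large k and all n,
    called [cantor_growth] below, which turns out to say that alpha is an Assouad
    exponent of C_a.

    The dimension of C_a is the least one because covering numbers at the scale
    A_k do not see the order of the gaps: each complementary set E needs about
    2^k balls of radius A_k. At most that many, since removing the first 2^k - 1
    gaps leaves 2^k intervals of total length at most 2^k A_k
    ([gap_complement_cover]); at least that many, since the later gaps are shorter
    than A_k, hence close to E, and have total length at least a constant times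
    2^k A_k ([gap_complement_cover_ge]). Covering E by balls of radius A_k and
    each of these by balls of radius A_(k+n) shows that every exponent of E
    satisfies the growth condition ([cantor_growth_of_exponent]). Conversely a
    ball with radius between A_(k+1) and A_k meets boundedly many intervals of
    step k, and each of them splits into 2^n intervals of step k+n, so the growth
    condition gives exponents of C_a ([assouad_exponent_cantor_set]). Hence every
    exponent of E is an exponent of C_a.

    The dimension 1 is attained by laying out the gaps in the order of their lengths,
    where long runs of gaps of comparable length imitate an arithmetic progression
    ([decreasing_set_exponent]). For s strictly between dim C_a and 1, a sparse
    subsequence b of a is chosen whose Cantor set has dimension exactly s
    ([sparse_exponents]): a gap at step k of its construction has length about
    t_k, where t_(k+1) is at most 2^(-1/s) t_k, with equality on longer and longer
    ranges of k. The remaining terms, in their order, form a sequence b'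
    comparable to a, so that s is an exponent of the Cantor set of b'
    ([cantor_growth_comparison]). The two Cantor sets placed side by side form a
    complementary set of a ([complementary_set_concatenation]), and its dimension
    is the larger of the two, which is s. *)

(** * Covers and Assouad exponents *)

Section Covers.
Context {R : realType}.
Implicit Types (F G : set R) (s : seq R) (r S x y p q c al be rho : R).

(** Lists of centres, possibly with repetitions, concatenate and map more easily
    than the families of centres in the definition of the covering number. *)
Definition covered r F s := forall y, F y -> exists2 x, x \in s & `|x - y| <= r.

Definition ball_part x S F : set R := [set y | F y /\ `|x - y| <= S].

Lemma ball_partE x S F : 0 < S -> closed_ball x S `&` F = ball_part x S F.
Proof.
move=> S0; rewrite closed_ballE //; apply/seteqP.
by split=> y /= [] h1 h2; split.
Qed.

Lemma covered_subset r F G s : F `<=` G -> covered r G s -> covered r F s.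
Proof. by move=> FG Gs y /FG /Gs. Qed.

Lemma covered_setU r F G s t :
  covered r F s -> covered r G t -> covered r (F `|` G) (s ++ t).
Proof.
move=> Fs Gt y [/Fs|/Gt] [x xs xy]; exists x => //; rewrite mem_cat xs ?orbT //.
Qed.

Lemma covered_itv r p q : 0 < r -> p <= q ->
  exists s, covered r [set y | p <= y <= q] s /\ (size s)%:R <= (q - p) / r + 1.
Proof.
move=> r0 pq.
exists [seq p + r * i%:R | i <- iota 0 (Num.trunc ((q - p) / r)).+1]; split.
  move=> y /andP[py yq].
  have yr0 : 0 <= (y - p) / r by rewrite divr_ge0 ?subr_ge0 // ltW.
  have /andP[h1 h2] := trunc_itv yr0.
  exists (p + r * (Num.trunc ((y - p) / r))%:R).
    apply: (map_f (fun i => p + r * i%:R)); rewrite mem_iota add0n ltnS leq0n /=; apply: le_truncn.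
    by rewrite ler_pM2r ?invr_gt0 // lerD2r.
  rewrite ler_pdivlMr // in h1; rewrite ltr_pdivrMr // -natr1 in h2.
  by rewrite ler_norml; apply/andP; split; lra.
have yr0 : 0 <= (q - p) / r by rewrite divr_ge0 ?subr_ge0 // ltW.
have /andP[h1 _] := trunc_itv yr0.
by rewrite size_map size_iota -natr1 lerD2r.
Qed.

Lemma covering_number_le r F s :
  0 < r -> covered r F s -> (covering_number r F <= (size s)%:R%:E)%E.
Proof.
move=> r0 Fs; apply: ereal_inf_lbound; exists (size s) => //.
exists (fun i : 'I_(size s) => s`_i) => y /Fs [x xs xy].
have hi : (index x s < size s)%N by rewrite index_mem.
exists (Ordinal hi) => //=.
by rewrite closed_ballE // nth_index.
Qed.

Lemma covering_number_lt r F y :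
  0 < r -> (covering_number r F < y%:E)%E ->
  exists s, covered r F s /\ (size s)%:R < y.
Proof.
move=> r0 /ereal_inf_lt [_ [n [x Fx] <-]]; rewrite lte_fin => ny.
exists [seq x i | i <- enum 'I_n]; split; last by rewrite size_map size_enum_ord.
move=> z /Fx [i _ /=]; rewrite closed_ballE // => xz.
by exists (x i) => //; apply: map_f; rewrite mem_enum.
Qed.

Lemma assouad_exponent_intro F al c rho : 0 < c -> 0 < rho ->
  (forall r S x, 0 < r -> r < S -> S < rho -> F x ->
    exists s, covered r (ball_part x S F) s /\ (size s)%:R <= c * (S / r) `^ al) ->
  assouad_exponent F al.
Proof.
move=> c0 rho0 H; exists c, rho; split=> // r S r0 rS Srho.
apply: ge_ereal_sup => _ [x Fx <-].
have [s [Fs sc]] := H r S x r0 rS Srho Fx.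
rewrite ball_partE; last exact: lt_trans rS.
by apply: le_trans (covering_number_le r0 Fs) _; rewrite lee_fin.
Qed.

(** The covering number is an infimum; doubling the constant leaves room to pick an
    actual cover. *)
Lemma assouad_exponent_elim F al : assouad_exponent F al ->
  exists c rho, [/\ 0 < c, 0 < rho & forall r S x, 0 < r -> r < S -> S < rho ->
    F x ->
    exists s, covered r (ball_part x S F) s /\ (size s)%:R <= c * (S / r) `^ al].
Proof.
move=> [c [rho [c0 rho0 H]]]; exists (2 * c), rho; split=> //; first lra.
move=> r S x r0 rS Srho Fx.
have S0 : 0 < S by exact: lt_trans rS.
have p0 : 0 < c * (S / r) `^ al by rewrite mulr_gt0 // powR_gt0 // divr_gt0.
have /covering_number_lt : (covering_number r (ball_part x S F)
    < (2 * c * (S / r) `^ al)%:E)%E.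
  apply: (@le_lt_trans _ _ (c * (S / r) `^ al)%:E); last by rewrite lte_fin; lra.
  apply: le_trans (H r S r0 rS Srho); apply: ereal_sup_ubound.
  by exists x => //; rewrite ball_partE.
by move=> /(_ r0) [s [sF ss]]; exists s; split=> //; exact: ltW.
Qed.

Lemma powR_gt1 x y : 1 < x -> 0 < y -> 1 < x `^ y.
Proof.
move=> x1 y0; rewrite lt_neqAle -{2}(powRr0 x) ler_powR; try lra.
by rewrite andbT eq_sym powR_eq1; apply/negP => /or3P [/eqP|?|/eqP]; lra.
Qed.

(** A cover of a non-empty set has at least one ball, whereas for [al < 0] the
    bound tends to 0 with [r]. *)
Lemma assouad_exponent_ge0 F al : F !=set0 -> assouad_exponent F al -> 0 <= al.
Proof.
move=> [x Fx] /assouad_exponent_elim [c [rho [c0 rho0 H]]].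
rewrite leNgt; apply/negP => al0.
(* At the scales S = rho / 2 and r = S / q the bound c (S / r)^al is
   c / (1 + c) < 1. *)
pose q := (1 + c) `^ (- al^-1).
have q1 : 1 < q.
  by apply: powR_gt1; [lra | rewrite oppr_gt0 invr_lt0].
have q0 : 0 < q by lra.
have r0 : 0 < rho / 2 / q by rewrite !divr_gt0.
have rS : rho / 2 / q < rho / 2 by rewrite ltr_pdivrMr //; nra.
have Eq : rho / 2 / (rho / 2 / q) = q by field; rewrite !gt_eqF.
have [|s [Fs]] := H _ _ x r0 rS _ Fx; first lra.
rewrite Eq /q -powRrM mulNr mulVf; last lra.
rewrite powR_inv1; last lra.
have [z zs _] : exists2 z, z \in s & `|z - x| <= rho / 2 / q.
  apply: Fs; split => //; rewrite subrr normr0; lra.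
have s1 : (1 : R) <= (size s)%:R by rewrite ler1n; case: (s) zs.
have c1 : 0 < 1 + c by lra.
move=> /(le_trans s1); rewrite -ler_pdivrMr ?divr1 ?invr_gt0 //.
by rewrite invrK mul1r; lra.
Qed.

Lemma assouad_exponent_le F al be :
  al <= be -> assouad_exponent F al -> assouad_exponent F be.
Proof.
move=> albe /assouad_exponent_elim [c [rho [c0 rho0 H]]].
apply: (assouad_exponent_intro c0 rho0) => r S x r0 rS Srho Fx.
have [s [Fs ss]] := H _ _ _ r0 rS Srho Fx; exists s; split=> //.
apply: le_trans ss _; rewrite ler_pM2l // ler_powR // ler_pdivlMr //; lra.
Qed.

Lemma assouad_exponent_subset F G al :
  F `<=` G -> assouad_exponent G al -> assouad_exponent F al.
Proof.
move=> FG /assouad_exponent_elim [c [rho [c0 rho0 H]]].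
apply: (assouad_exponent_intro c0 rho0) => r S x r0 rS Srho Fx.
have [s [Fs ss]] := H _ _ _ r0 rS Srho (FG _ Fx); exists s; split=> //.
by apply: covered_subset Fs => y [/FG].
Qed.

Lemma assouad_exponent_translate F al t :
  assouad_exponent F al -> assouad_exponent [set y | F (y - t)] al.
Proof.
move=> /assouad_exponent_elim [c [rho [c0 rho0 H]]].
apply: (assouad_exponent_intro c0 rho0) => r S x r0 rS Srho Fx.
have [s [Fs ss]] := H _ _ _ r0 rS Srho Fx; exists [seq z + t | z <- s].
split; last by rewrite size_map.
move=> y [/= Fy xy]; have [|z zs zy] := Fs (y - t).
  by split=> //; rewrite opprB addrA subrK.
exists (z + t); first exact: map_f.
by rewrite -addrA -[t - y]opprB.
Qed.

(** A ball centred at a point of one set may meet the other set far from its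
    centre; the part it meets lies in a ball of twice the radius centred in the
    other set. *)
Lemma ball_part_cover F c rho al : 0 < c ->
  (forall r S x, 0 < r -> r < S -> S < rho -> F x ->
    exists s, covered r (ball_part x S F) s /\ (size s)%:R <= c * (S / r) `^ al) ->
  forall r S x, 0 < r -> r < S -> 2 * S < rho ->
    exists s, covered r (ball_part x S F) s /\
      (size s)%:R <= c * 2 `^ al * (S / r) `^ al.
Proof.
move=> c0 H r S x r0 rS Srho.
have [[y [Fy xy]]|F0] := pselect (ball_part x S F !=set0); last first.
  exists [::]; split; last by rewrite !mulr_ge0 ?powR_ge0 // ltW.
  by move=> y Fy; case: F0; exists y.
have [|s [Fs ss]] := H r (2 * S) y r0 _ Srho Fy; first lra.
exists s; split.
  apply: covered_subset Fs => z [Fz xz]; split => //.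
  by move: xy xz; rewrite !ler_norml => /andP[? ?] /andP[? ?]; apply/andP; split; lra.
apply: le_trans ss _; rewrite -mulrA -mulrA powRM //; try lra.
by rewrite divr_ge0; lra.
Qed.

Lemma assouad_exponent_setU F G al : assouad_exponent F al ->
  assouad_exponent G al -> assouad_exponent (F `|` G) al.
Proof.
move=> /assouad_exponent_elim [c [rho [c0 rho0 H]]].
move=> /assouad_exponent_elim [d [tau [d0 tau0 K]]].
have p2 : 0 < (2 : R) `^ al by rewrite powR_gt0.
apply: (@assouad_exponent_intro _ _ ((c + d) * 2 `^ al) (Num.min rho tau / 2)).
- by rewrite mulr_gt0 //; lra.
- by rewrite divr_gt0 // lt_min rho0.
move=> r S x r0 rS; rewrite ltr_pdivlMr // lt_min mulrC => /andP[S1 S2] _.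
have [s [Fs ss]] := ball_part_cover c0 H x r0 rS S1.
have [t [Gt st]] := ball_part_cover d0 K x r0 rS S2.
exists (s ++ t); split.
  apply: (@covered_subset _ _ (ball_part x S F `|` ball_part x S G)).
    by move=> y [[Fy|Gy] xy]; [left|right].
  exact: covered_setU.
by rewrite size_cat natrD !mulrDl; lra.
Qed.

Lemma assouad_exponent1 F : assouad_exponent F 1.
Proof.
apply: (@assouad_exponent_intro _ _ 3 1) => // r S x r0 rS _ _.
have [|s [Hs ss]] := @covered_itv r (x - S) (x + S) r0; first lra.
exists s; split.
  apply: covered_subset Hs => y [_] /=.
  by rewrite ler_norml => /andP[? ?]; apply/andP; split; lra.
apply: le_trans ss _; rewrite powRr1; last by rewrite divr_ge0; lra.
have : 1 <= S / r by rewrite ler_pdivlMr //; lra.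
have -> : (x + S - (x - S)) / r = 2 * (S / r) by ring.
lra.
Qed.

(** Covering numbers are submultiplicative across scales: a ball of a coarse
    cover that meets the set lies in a ball of twice the radius centred in the
    set, to which the fine covers apply. *)
Lemma covered_refine F G r S (B : R) s : G `<=` F -> 0 <= B ->
  (forall x, F x ->
     exists t, covered r (ball_part x (2 * S) F) t /\ (size t)%:R <= B) ->
  covered S G s ->
  exists t, covered r G t /\ (size t)%:R <= B * (size s)%:R.
Proof.
move=> GF B0 H; elim: s G GF => [|z s IH] G GF Gs.
  by exists [::]; split; [move=> y /Gs [] | rewrite mulr0].
have [||t [Ht st]] := IH (G `\` ball_part z S F).
- by move=> y [/GF].
- move=> y [Gy zy]; have [x] := Gs y Gy.
  rewrite inE => /orP[/eqP -> xy|xs xy]; last by exists x.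
  by case: zy; split => //; exact: GF.
have [[y [[Fy zy] Gy]]|F0] := pselect (ball_part z S F `&` G !=set0); last first.
  exists t; split.
    move=> y Gy; apply: Ht; split=> // zy; apply: F0; exists y; split=> //.
  by apply: le_trans st _; rewrite ler_wpM2l // ler_nat /=.
have [u [Hu su]] := H y Fy; exists (u ++ t); split; last first.
  by rewrite size_cat natrD /= -natr1; lra.
apply: (@covered_subset _ _ (ball_part y (2 * S) F `|` (G `\` ball_part z S F))).
  move=> w Gw; have [[Fw zw]|nz] := pselect (ball_part z S F w); last by right.
  left; split=> //.
  by move: zy zw; rewrite !ler_norml => /andP[? ?] /andP[? ?]; apply/andP; split; lra.
exact: covered_setU.
Qed.

End Covers.

(** * Complementary sets as systems of gaps *)

Section Gaps.
Context {R : realType}.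
Implicit Types (a u : nat -> R) (E : set R) (r p q x y L : R) (s : seq nat).

Lemma le_partial_sum_total_length a n : positive_terms a -> summable_terms a ->
  \sum_(1 <= j < n) a j <= total_length a.
Proof.
move=> a0 asum.
apply: (@nondecreasing_cvgn_le _ (fun n => \sum_(1 <= j < n) a j)) => //.
apply/nondecreasing_seqP => -[|m]; first by rewrite !big_geq.
by rewrite [leRHS]big_nat_recr //= lerDl ltW // a0.
Qed.

Lemma total_length_le a (B : R) : summable_terms a ->
  (forall n, \sum_(1 <= j < n) a j <= B) -> total_length a <= B.
Proof. by move=> asum aB; apply: limr_le => //; apply: nearW. Qed.

Definition separated_gaps a u := forall i j, (0 < i)%N -> (0 < j)%N -> i != j ->
  u i + a i <= u j \/ u j + a j <= u i.

Definition gaps_in a u p q s :=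
  forall j, j \in s -> [/\ (0 < j)%N, p <= u j & u j + a j <= q].

Definition gap_system a u L :=
  separated_gaps a u /\ forall j, (0 < j)%N -> 0 <= u j /\ u j + a j <= L.

Definition gap_complement a u L : set R :=
  [set x | 0 <= x <= L /\ forall j, (0 < j)%N -> ~~ (u j < x < u j + a j)].

(** As its length is prescribed, a gap is known from its left endpoint, and
    disjointness becomes an order condition on these endpoints. *)
Lemma complementary_setP a E : positive_terms a ->
  complementary_set a E <->
  exists u, gap_system a u (total_length a) /\
    E = gap_complement a u (total_length a).
Proof.
move=> a0; split.
  move=> [_ [U [Uitv Usub Utriv ->]]].
  have /choice [u Uu] : forall j, exists x, (0 < j)%N -> U j = `]x, x + a j[%classic.
    by move=> [|j]; [exists 0 | have [//|x Ux] := Uitv j.+1; exists x].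
  exists u; split; first split.
  - move=> i j i0 j0 ij; have [h1|h1] := leP (u i + a i) (u j); first by left.
    have [h2|h2] := leP (u j + a j) (u i); first by right.
    have ai := a0 _ i0; have aj := a0 _ j0.
    move/eqP: ij; case; apply: Utriv => //.
    rewrite !Uu //.
    (* Two gaps that are not separated share the midpoint of their overlap. *)
    exists ((Num.max (u i) (u j) + Num.min (u i + a i) (u j + a j)) / 2).
    rewrite /= !in_itv /=.
    by have [?|?] := leP (u i) (u j); have [?|?] := leP (u i + a i) (u j + a j);
      split; apply/andP; split; lra.
  - move=> j j0; have aj := a0 _ j0; have := Usub _ j0; rewrite Uu // => h.
    split; rewrite leNgt; apply/negP => hlt.
    + have := h ((u j + Num.min 0 (u j + a j)) / 2).
      rewrite /= !in_itv /=; have [?|?] := leP 0 (u j + a j) => h1;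
        (have /andP[] := h1 ltac:(apply/andP; split; lra)); lra.
    + have := h ((u j + a j + Num.max (total_length a) (u j)) / 2).
      rewrite /= !in_itv /=; have [?|?] := leP (total_length a) (u j) => h1;
        (have /andP[] := h1 ltac:(apply/andP; split; lra)); lra.
  - apply/seteqP; split=> x /=; rewrite in_itv /=.
      move=> [x0L xU]; split=> // j j0; apply/negP => xj; apply: xU.
      by exists j => //; rewrite Uu //= in_itv.
    move=> [x0L xU]; split=> // -[j j0]; rewrite Uu //= in_itv /= => xj.
    by have := xU j j0; rewrite xj.
move=> [u [[sep u0L] ->]].
have EU : gap_complement a u (total_length a) = `[0, total_length a]%classic `\`
    \bigcup_(j in [set j | (0 < j)%N]) `]u j, u j + a j[%classic.
  apply/seteqP; split=> x /=; rewrite in_itv /=.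
    move=> [x0L xU]; split=> // -[j j0] /=; rewrite in_itv /= => xj.
    by have := xU j j0; rewrite xj.
  move=> [x0L xU]; split=> // j j0; apply/negP => xj; apply: xU.
  by exists j => //; rewrite /= in_itv.
split.
  rewrite EU setDE; apply: closedI; first exact: interval_closed.
  by apply: open_closedC; apply: bigcup_open => j _; exact: interval_open.
exists (fun j => `]u j, u j + a j[%classic); split=> //.
- by move=> j _; exists (u j).
- move=> j j0 x /=; have [u1 u2] := u0L _ j0; rewrite !in_itv /= => /andP[? ?].
  by apply/andP; split; lra.
- move=> i j i0 j0 [x [/=]]; rewrite !in_itv /= => /andP[? ?] /andP[? ?].
  by apply/eqP/negPn/negP => /(sep i j i0 j0) []; lra.
Qed.

Lemma gap_left_in_complement a u L j : positive_terms a -> gap_system a u L ->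
  (0 < j)%N -> gap_complement a u L (u j).
Proof.
move=> a0 [sep u0L] j0; have [u1 u2] := u0L _ j0; have aj := a0 _ j0; split.
  by apply/andP; split; lra.
move=> i i0; have ai := a0 _ i0; apply/negP => /andP[h1 h2].
have [ij|/(sep _ _ i0 j0) [?|?]] := eqVneq i j; last 2 first.
- lra.
- lra.
by rewrite ij ltxx in h1.
Qed.

(** Removing one gap splits an interval in two, and separation puts every other
    gap wholly into one of the two halves; both claims are additive over the
    halves, and are elementary when no gap is left. *)
Lemma gaps_in_interval a u : positive_terms a -> separated_gaps a u ->
  forall s p q, p <= q -> uniq s -> gaps_in a u p q s ->
  \sum_(j <- s) a j <= q - p /\
  forall r, 0 < r -> exists t,
    covered r [set y | p <= y <= q /\
                       forall j, j \in s -> ~~ (u j < y < u j + a j)] t /\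
    (size t)%:R <= (q - p - \sum_(j <- s) a j) / r + (size s)%:R + 1.
Proof.
move=> a0 sep s; have [n] := ubnP (size s).
elim: n s => // n IH [|i s] sn p q pq us sin.
  split; first by rewrite big_nil subr_ge0.
  move=> r r0; have [t [ct st]] := covered_itv r0 pq.
  exists t; split; first by apply: covered_subset ct => y [].
  by rewrite big_nil subr0 addr0.
have [i0 pi iq] := sin i (mem_head _ _); have ai := a0 _ i0.
pose P j := u j + a j <= u i.
have uns : uniq s by case/andP: us.
have inl : i \notin s by case/andP: us.
have sins j : j \in s -> j \in i :: s by rewrite inE orbC => ->.
have sizeP : (size [seq j <- s | P j] + size [seq j <- s | ~~ P j] = size s)%N.
  by rewrite !size_filter -(count_predC P).
rewrite /= ltnS in sn.
have sumE : \sum_(j <- i :: s) a j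
    = a i + (\sum_(j <- [seq j <- s | P j]) a j + \sum_(j <- [seq j <- s | ~~ P j]) a j).
  by rewrite big_cons !big_filter [in LHS](bigID P).
have [||||s1 c1] := IH [seq j <- s | P j] _ p (u i).
- by lia.
- exact: pi.
- exact: filter_uniq.
- move=> j; rewrite mem_filter => /andP[Pj /sins js].
  by have [] := sin j js; split.
have [||||s2 c2] := IH [seq j <- s | ~~ P j] _ (u i + a i) q.
- by lia.
- exact: iq.
- exact: filter_uniq.
- move=> j; rewrite mem_filter => /andP[/= Pj js].
  have [j0 ? ?] := sin j (sins j js); split=> //.
  have [|//|] := sep i j i0 j0; last by move/negP: Pj.
  by apply: contraNneq inl => ->.
split; first by rewrite sumE; lra.
move=> r r0; have [t1 [ct1 st1]] := c1 r r0; have [t2 [ct2 st2]] := c2 r r0.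
exists (t1 ++ t2); split.
  apply: covered_subset (covered_setU ct1 ct2) => y [/andP[py yq] yg].
  have := yg i (mem_head _ _); rewrite negb_and -!leNgt => /orP[yi|iy]; [left|right].
  - by split; [rewrite py|move=> j]; rewrite // mem_filter => /andP[_ /sins /yg].
  - by split; [rewrite yq iy|move=> j]; rewrite // mem_filter => /andP[_ /sins /yg].
rewrite size_cat natrD sumE /= -sizeP -addn1 !natrD.
suff <- : (u i - p - \sum_(j <- [seq j <- s | P j]) a j) / r
   + (q - (u i + a i) - \sum_(j <- [seq j <- s | ~~ P j]) a j) / r
   = (q - p - (a i + (\sum_(j <- [seq j <- s | P j]) a j +
                      \sum_(j <- [seq j <- s | ~~ P j]) a j))) / r
  by lra.
by rewrite -mulrDl; congr (_ / r); ring.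
Qed.

(** The first [n - 1] gaps leave [n] intervals, whose total length is the sum of
    the remaining gaps. *)
Lemma gap_complement_cover a u L n r : positive_terms a -> 0 <= L ->
  gap_system a u L -> 0 < r -> (0 < n)%N ->
  exists t, covered r (gap_complement a u L) t /\
    (size t)%:R <= (L - \sum_(1 <= j < n) a j) / r + n%:R.
Proof.
move=> a0 L0 [sep u0L] r0 n0.
have [||_ /(_ r r0) [t [ct st]]] :=
  gaps_in_interval a0 sep (s := index_iota 1 n) L0.
- exact: iota_uniq.
- by move=> j; rewrite mem_index_iota => /andP[j0 _]; have [] := u0L j j0; split.
exists t; split.
  apply: covered_subset ct => y [y0L yg]; split=> // j.
  by rewrite mem_index_iota => /andP[/yg].
apply: le_trans st _; rewrite subr0 -addrA lerD2l size_iota natr1 ler_nat; lia.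
Qed.

(** Each short gap starts in the set, hence in some ball, and so lies in the
    concentric interval with the right radius doubled. *)
Lemma sum_gaps_le_cover a u r : positive_terms a -> separated_gaps a u -> 0 < r ->
  forall (t : seq R) s, uniq s ->
  (forall j, j \in s ->
     [/\ (0 < j)%N, a j <= r & exists2 x, x \in t & `|x - u j| <= r]) ->
  \sum_(j <- s) a j <= 3 * r * (size t)%:R.
Proof.
move=> a0 sep r0; elim=> [|x t IH] s us st.
  case: s us st => [|j s] _ st; first by rewrite big_nil mulr0.
  by have [_ _ []] := st j (mem_head _ _).
rewrite (bigID (fun j => `|x - u j| <= r)) /= -[(size t).+1%:R]natr1 mulrDr mulr1.
rewrite -[X in X + _]big_filter -[X in _ + X]big_filter.
rewrite addrC; apply: lerD.
  apply: IH; first exact: filter_uniq.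
  move=> j; rewrite mem_filter => /andP[jx js]; have [j0 aj [y yt yj]] := st j js.
  split=> //; exists y => //; move: yt yj; rewrite inE => /orP[/eqP -> xj|//].
  by rewrite xj in jx.
have [|||] := @gaps_in_interval _ _ a0 sep
  [seq j <- s | `|x - u j| <= r] (x - r) (x + 2 * r).
- lra.
- exact: filter_uniq.
- move=> j; rewrite mem_filter ler_norml => /andP[/andP[? ?] js].
  by have [j0 aj _] := st j js; split=> //; lra.
lra.
Qed.

(** Neighbourhoods of the set swallow all short gaps, so a cover of the set has to
    account for their total length. *)
Lemma gap_complement_cover_ge a u n r (t : seq R) :
  positive_terms a -> summable_terms a -> gap_system a u (total_length a) ->
  0 < r -> (0 < n)%N -> (forall j, (n <= j)%N -> a j <= r) ->
  covered r (gap_complement a u (total_length a)) t ->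
  total_length a - \sum_(1 <= j < n) a j <= 3 * r * (size t)%:R.
Proof.
move=> a0 asum gs r0 n0 ar ct.
rewrite lerBlDl; apply: total_length_le => // m.
have Hnm : \sum_(n <= j < m) a j <= 3 * r * (size t)%:R.
  apply: (sum_gaps_le_cover a0 gs.1 r0); first exact: iota_uniq.
  move=> j; rewrite mem_index_iota => /andP[nj _].
  have j0 : (0 < j)%N by exact: leq_trans nj.
  split=> //; first exact: ar.
  exact/ct/gap_left_in_complement.
have [nm|mn] := leqP n m; first by rewrite (@big_cat_nat _ _ _ n) //= lerD2l.
have := ler_wpM2l (ltW r0) (ler0n R (size t)); rewrite mulr0 => h.
have : \sum_(1 <= j < m) a j <= \sum_(1 <= j < n) a j; last lra.
have [m0|m0] := posnP m.
  rewrite m0 big_geq // big_nat sumr_ge0 // => j /andP[j0 _]; exact/ltW/a0.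
rewrite [leRHS](@big_cat_nat _ _ _ m) ?(ltnW mn) //= lerDl big_nat sumr_ge0 // => j.
by move=> /andP[mj _]; exact/ltW/a0/leq_trans/mj.
Qed.

End Gaps.

Lemma sum_nat_shift (R : realType) (f : nat -> R) m n :
  \sum_(m <= i < m + n) f i = \sum_(0 <= l < n) f (m + l)%N.
Proof.
rewrite -{1}[m]add0n big_addn addKn.
by apply: eq_bigr => l _; rewrite addnC.
Qed.

(** * The Cantor set as a complementary set *)

Section Cantor.
Context {R : realType}.
Variable a : nat -> R.
Hypotheses (a0 : positive_terms a) (asum : summable_terms a).
Implicit Types (k j m n i l : nat) (x y r : R).

(** Partial sums of the gaps removed from the interval [j] of step [k]; they
    converge to [cantor_length a k j]. *)
Definition subtree_sum k j n : R :=
  \sum_(0 <= i < n) \sum_(0 <= l < 2 ^ i) a (2 ^ (k + i) + 2 ^ i * j + l)%N.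

Let node_gt0 k i j l : 0 < a (2 ^ (k + i) + 2 ^ i * j + l)%N.
Proof. by apply: a0; rewrite -addnA ltn_addr // expn_gt0. Qed.

Lemma subtree_sum_root n : subtree_sum 0 0 n = \sum_(1 <= m < 2 ^ n) a m.
Proof.
elim: n => [|n IH]; first by rewrite /subtree_sum !big_geq.
rewrite /subtree_sum big_nat_recr //= -/(subtree_sum 0 0 n) IH.
rewrite [RHS](@big_cat_nat _ _ _ (2 ^ n)) /=; last 2 first.
- by rewrite expn_gt0.
- by rewrite leq_exp2l.
congr (_ + _); rewrite expnS mul2n -addnn (sum_nat_shift a (2 ^ n)).
by apply: eq_bigr => l _; rewrite muln0 addn0 add0n.
Qed.

Lemma subtree_sum_split k j n : subtree_sum k j n.+1 =
  subtree_sum k.+1 j.*2 n + a (2 ^ k + j)%N + subtree_sum k.+1 j.*2.+1 n.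
Proof.
rewrite /subtree_sum big_nat_recl // expn0 big_nat1 addn0 mul1n addn0.
rewrite [RHS]addrAC [RHS]addrC; congr (_ + _); rewrite -big_split /=.
apply: eq_bigr => i _.
rewrite (@big_cat_nat _ _ _ (2 ^ i)) //=; last by rewrite leq_exp2l.
congr (_ + _).
  by apply: eq_bigr => l _; congr a; rewrite addSnnS expnS -mul2n; lia.
rewrite [in LHS]expnS mul2n -addnn (sum_nat_shift _ (2 ^ i)).
by apply: eq_bigr => l _; congr a; rewrite addSnnS -mul2n; lia.
Qed.

Lemma subtree_sum_nondecreasing k j :
  {homo subtree_sum k j : m n / (m <= n)%N >-> m <= n}.
Proof.
apply/nondecreasing_seqP => n; rewrite /subtree_sum big_nat_recr //= lerDl.
by apply: sumr_ge0 => l _; exact: ltW.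
Qed.

Lemma subtree_sum_le_total k j n : (j < 2 ^ k)%N ->
  subtree_sum k j n <= total_length a.
Proof.
elim: k j n => [|k IH] j n jk.
  have -> : j = 0%N by lia.
  by rewrite subtree_sum_root le_partial_sum_total_length.
have jk2 : (j./2 < 2 ^ k)%N by rewrite expnS in jk; lia.
apply: le_trans (IH j./2 n.+1 jk2); rewrite subtree_sum_split.
have ge0 i : 0 <= subtree_sum k.+1 i n.
  by apply: sumr_ge0 => ? _; apply: sumr_ge0 => ? _; exact: ltW.
have anode : 0 < a (2 ^ k + j./2)%N by apply: a0; rewrite ltn_addr ?expn_gt0.
have h1 := ge0 j./2.*2; have h2 := ge0 j./2.*2.+1.
rewrite -{1}(odd_double_half j); case: (odd j); rewrite ?add1n ?add0n; lra.
Qed.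

Lemma cvg_subtree_sum k j : (j < 2 ^ k)%N ->
  subtree_sum k j n @[n --> \oo] --> cantor_length a k j.
Proof.
move=> jk; have : cvgn (subtree_sum k j).
  apply: nondecreasing_is_cvgn; first exact: subtree_sum_nondecreasing.
  by exists (total_length a) => _ [n _ <-]; exact: subtree_sum_le_total.
exact.
Qed.

Lemma subtree_sum_le k j n : (j < 2 ^ k)%N ->
  subtree_sum k j n <= cantor_length a k j.
Proof.
move=> jk; apply: (@nondecreasing_cvgn_le _ (subtree_sum k j)).
  exact: subtree_sum_nondecreasing.
by apply/cvg_ex; exists (cantor_length a k j); exact: cvg_subtree_sum.
Qed.

Lemma cantor_length_le k j (B : R) : (j < 2 ^ k)%N ->
  (forall n, subtree_sum k j n <= B) -> cantor_length a k j <= B.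
Proof.
move=> jk h; apply: limr_le; last exact: nearW.
by apply/cvg_ex; exists (cantor_length a k j); exact: cvg_subtree_sum.
Qed.

Lemma node_le_cantor_length k j : (j < 2 ^ k)%N ->
  a (2 ^ k + j)%N <= cantor_length a k j.
Proof.
move=> jk; apply: le_trans (subtree_sum_le 1 jk).
by rewrite /subtree_sum !big_nat1 expn0 mul1n !addn0.
Qed.

Lemma cantor_length_gt0 k j : (j < 2 ^ k)%N -> 0 < cantor_length a k j.
Proof.
move=> jk; apply: lt_le_trans (node_le_cantor_length jk).
by apply: a0; rewrite ltn_addr ?expn_gt0.
Qed.

Lemma cantor_length_root : cantor_length a 0 0 = total_length a.
Proof.
apply: le_anti; apply/andP; split.
  by apply: cantor_length_le => // n; exact: subtree_sum_le_total.
apply: total_length_le => // n; apply: le_trans (@subtree_sum_le 0 0 n isT).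
rewrite subtree_sum_root; have [->|n0] := posnP n; first by rewrite !big_geq.
rewrite [leRHS](@big_cat_nat _ _ _ n) //=; last exact/ltnW/ltn_expl.
by rewrite lerDl big_nat sumr_ge0 // => i /andP[ni _]; exact/ltW/a0/leq_trans/ni.
Qed.

Lemma cantor_length_split k j : (j < 2 ^ k)%N -> cantor_length a k j =
  cantor_length a k.+1 j.*2 + a (2 ^ k + j)%N + cantor_length a k.+1 j.*2.+1.
Proof.
move=> jk; have [j1 j2] : (j.*2 < 2 ^ k.+1)%N /\ (j.*2.+1 < 2 ^ k.+1)%N.
  by rewrite expnS; lia.
have h1 : subtree_sum k j n.+1 @[n --> \oo] --> cantor_length a k j.
  by rewrite (cvg_shiftS (subtree_sum k j)); exact: cvg_subtree_sum.
have h2 : subtree_sum k j n.+1 @[n --> \oo] --> cantor_length a k.+1 j.*2 +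
    a (2 ^ k + j)%N + cantor_length a k.+1 j.*2.+1.
  under eq_fun do rewrite subtree_sum_split.
  apply: cvgD; last exact: cvg_subtree_sum.
  by apply: cvgD; [exact: cvg_subtree_sum|exact: cvg_cst].
exact: (cvg_unique _ h1 h2).
Qed.

Definition cantor_right k j := cantor_left a k j + cantor_length a k j.
Definition cantor_gap k j := cantor_left a k j + cantor_length a k.+1 j.*2.

Lemma cantor_left_even k j : cantor_left a k.+1 j.*2 = cantor_left a k j.
Proof. by rewrite /= doubleK odd_double addr0. Qed.

Lemma cantor_left_odd k j :
  cantor_left a k.+1 j.*2.+1 = cantor_gap k j + a (2 ^ k + j)%N.
Proof. by rewrite /= uphalf_double odd_double addrA. Qed.

Lemma cantor_right_even k j : cantor_right k.+1 j.*2 = cantor_gap k j.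
Proof. by rewrite /cantor_right cantor_left_even. Qed.

Lemma cantor_right_odd k j : (j < 2 ^ k)%N ->
  cantor_right k.+1 j.*2.+1 = cantor_right k j.
Proof.
move=> jk; rewrite /cantor_right cantor_left_odd /cantor_gap.
by rewrite (cantor_length_split jk) !addrA.
Qed.

Lemma half_lt_expn k j : (j < 2 ^ k.+1)%N -> (j./2 < 2 ^ k)%N.
Proof. by rewrite expnS; lia. Qed.

Lemma cantor_gap_in k j : (j < 2 ^ k)%N ->
  cantor_left a k j <= cantor_gap k j /\
  cantor_gap k j + a (2 ^ k + j)%N <= cantor_right k j.
Proof.
move=> jk; have [j1 j2] : (j.*2 < 2 ^ k.+1)%N /\ (j.*2.+1 < 2 ^ k.+1)%N.
  by rewrite expnS; lia.
have h1 := cantor_length_gt0 j1; have h2 := cantor_length_gt0 j2.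
by rewrite /cantor_right /cantor_gap (cantor_length_split jk); split; lra.
Qed.

Lemma cantor_child_in k j : (j < 2 ^ k.+1)%N ->
  cantor_left a k j./2 <= cantor_left a k.+1 j /\
  cantor_right k.+1 j <= cantor_right k j./2.
Proof.
move=> jk; have jk2 := half_lt_expn jk.
have [h1 h2] := cantor_gap_in jk2.
have anode : 0 < a (2 ^ k + j./2)%N by apply: a0; rewrite ltn_addr ?expn_gt0.
rewrite -{2 3}(odd_double_half j); case: (odd j); rewrite ?add1n ?add0n.
  by rewrite cantor_left_odd cantor_right_odd //; split; lra.
by rewrite cantor_left_even cantor_right_even //; split; lra.
Qed.

Lemma cantor_descendant_in k n j : (j < 2 ^ (k + n))%N ->
  cantor_left a k (j %/ 2 ^ n) <= cantor_left a (k + n) j /\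
  cantor_right (k + n) j <= cantor_right k (j %/ 2 ^ n).
Proof.
elim: n j => [|n IH] j; first by rewrite addn0 expn0 divn1.
rewrite addnS => jk; have [h1 h2] := cantor_child_in jk.
have [h3 h4] := IH _ (half_lt_expn jk).
rewrite expnS divnMA divn2; split; lra.
Qed.

Lemma cantor_interval_lt k i j : (i < j)%N -> (j < 2 ^ k)%N ->
  cantor_right k i < cantor_left a k j.
Proof.
elim: k i j => [|k IH] i j ij jk; first by rewrite expn0 in jk; lia.
have ik : (i < 2 ^ k.+1)%N by exact: ltn_trans jk.
have [_ h1] := cantor_child_in ik; have [h2 _] := cantor_child_in jk.
have jk2 := half_lt_expn jk.
have [hij|hij] := ltnP i./2 j./2; first by have := IH _ _ hij jk2; lra.
have [h [-> ->]] : exists h, i = h.*2 /\ j = h.*2.+1 by exists j./2; lia.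
rewrite cantor_right_even cantor_left_odd.
by rewrite ltrDl a0 // ltn_addr ?expn_gt0.
Qed.

(** The gap [j] of step [k] is disjoint from all intervals of step [k.+1], because
    it lies between the two children of its own interval. This separates it from
    all later gaps. *)
Lemma cantor_gap_interval k i j : (j < 2 ^ k)%N -> (i < 2 ^ k.+1)%N ->
  cantor_right k.+1 i <= cantor_gap k j \/
  cantor_gap k j + a (2 ^ k + j)%N <= cantor_left a k.+1 i.
Proof.
move=> jk ik; have [h1 h2] := cantor_gap_in jk.
have [h3 h4] := cantor_child_in ik; have ik2 := half_lt_expn ik.
have [hij|hij|hij] := ltngtP i./2 j.
- by have := cantor_interval_lt hij jk; left; lra.
- by have := cantor_interval_lt hij ik2; right; lra.
rewrite -(odd_double_half i) hij; case: (odd i); rewrite ?add1n ?add0n.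
- by right; rewrite cantor_left_odd.
- by left; rewrite cantor_right_even.
Qed.

(** Gaps are numbered in the order in which the construction removes them, so
    that gap [m] sits at level [trunc_log 2 m]. *)
Definition cantor_gap_left m := cantor_gap (trunc_log 2 m) (m - 2 ^ trunc_log 2 m).

Lemma node_coordinates m : (0 < m)%N ->
  exists k j, [/\ (j < 2 ^ k)%N, m = (2 ^ k + j)%N &
    cantor_gap_left m = cantor_gap k j].
Proof.
move=> m0; have /andP[h1 h2] := trunc_log_bounds (isT : 1 < 2)%N m0.
exists (trunc_log 2 m), (m - 2 ^ trunc_log 2 m)%N; split=> //.
- by rewrite expnS in h2; lia.
- by rewrite subnKC.
Qed.

Lemma cantor_gap_leftE k j : (j < 2 ^ k)%N ->
  cantor_gap_left (2 ^ k + j) = cantor_gap k j.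
Proof.
move=> jk; rewrite /cantor_gap_left (@trunc_log_eq _ k) //; first by rewrite addKn.
by rewrite expnS; lia.
Qed.

Lemma cantor_right_root : cantor_right 0 0 = total_length a.
Proof. by rewrite /cantor_right cantor_length_root add0r. Qed.

Lemma cantor_interval_in k j : (j < 2 ^ k)%N ->
  0 <= cantor_left a k j /\ cantor_right k j <= total_length a.
Proof.
move=> jk; have := @cantor_descendant_in 0 k j; rewrite add0n divn_small //.
by rewrite cantor_right_root; exact.
Qed.

Lemma cantor_gap_system : gap_system a cantor_gap_left (total_length a).
Proof.
split; last first.
  move=> m /node_coordinates [k [j [jk -> ->]]].
  have [h1 h2] := cantor_gap_in jk; have [h3 h4] := cantor_interval_in jk.
  by split; lra.
move=> m n /node_coordinates [k [i [ik -> ->]]] /node_coordinates [l [j [jl -> ->]]].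
(* A later gap lies in its ancestor of the step after that of the earlier gap. *)
have below (p q i' j' : nat) : (p < q)%N -> (i' < 2 ^ p)%N -> (j' < 2 ^ q)%N ->
    cantor_gap p i' + a (2 ^ p + i')%N <= cantor_gap q j' \/
    cantor_gap q j' + a (2 ^ q + j')%N <= cantor_gap p i'.
  move=> pq ip jq; have Eq : q = (p.+1 + (q - p.+1))%N by rewrite subnKC.
  have [h1 h2] := cantor_gap_in jq; rewrite Eq in jq.
  have [] := cantor_descendant_in jq; rewrite -Eq => h3 h4.
  have [|h5|h5] := @cantor_gap_interval p (j' %/ 2 ^ (q - p.+1)) i' ip.
  - by rewrite ltn_divLR ?expn_gt0 // -expnD.
  - by right; lra.
  - by left; lra.
have [kl|lk|kl] := ltngtP k l.
- by move=> _; exact: below.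
- by move=> _; have [?|?] := below l k j i lk jl ik; [right|left].
rewrite -{}kl in jl *; rewrite eqn_add2l => ij.
have [h1 h2] := cantor_gap_in ik; have [h3 h4] := cantor_gap_in jl.
have [ij'|ji|/eqP] := ltngtP i j; last by rewrite (negbTE ij).
- by have := cantor_interval_lt ij' jl; left; lra.
- by have := cantor_interval_lt ji ik; right; lra.
Qed.

Lemma cantor_setP x : cantor_set a x <->
  forall k, exists2 j, (j < 2 ^ k)%N & cantor_left a k j <= x <= cantor_right k j.
Proof.
split=> [xC k|h k _]; last first.
  by have [j jk xj] := h k; exists j => //; rewrite /cantor_interval /= in_itv.
have [j /= jk xj] := xC k.+1 isT.
have /andP[h1 h2] : cantor_left a k.+1 j <= x <= cantor_right k.+1 j by [].
exists j./2; first exact: half_lt_expn.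
by have [h3 h4] := cantor_child_in jk; apply/andP; split; lra.
Qed.

Lemma cantor_setE : cantor_set a =
  gap_complement a cantor_gap_left (total_length a).
Proof.
apply/seteqP; split=> x.
  move=> /cantor_setP xC; split.
    have [j] := xC 0%N; rewrite expn0 => j0; have -> : j = 0%N by lia.
    by rewrite cantor_right_root.
  move=> m /node_coordinates [k [j [jk -> ->]]]; apply/negP => /andP[h1 h2].
  have [i ik /andP[h3 h4]] := xC k.+1.
  by have [?|?] := cantor_gap_interval jk ik; lra.
move=> [x0L xg]; apply/cantor_setP; elim=> [|k [j jk /andP[h1 h2]]].
  by exists 0%N; rewrite // cantor_right_root.
have := xg (2 ^ k + j)%N; rewrite ltn_addr ?expn_gt0 // cantor_gap_leftE // => /(_ isT).
rewrite negb_and -!leNgt => /orP[h|h]; [exists j.*2 | exists j.*2.+1];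
  rewrite ?expnS; try lia.
- by rewrite cantor_left_even cantor_right_even h1.
- by rewrite cantor_left_odd cantor_right_odd // h.
Qed.

Lemma complementary_cantor_set : complementary_set a (cantor_set a).
Proof.
apply/complementary_setP => //; exists cantor_gap_left.
by split; [exact: cantor_gap_system | exact: cantor_setE].
Qed.

Lemma sum_double n (f : nat -> R) :
  \sum_(0 <= j < n.*2) f j = \sum_(0 <= j < n) (f j.*2 + f j.*2.+1).
Proof.
elim: n => [|n IH]; first by rewrite !big_geq.
by rewrite doubleS !big_nat_recr //= IH addrA.
Qed.

Lemma sum_cantor_length k : total_length a - \sum_(1 <= j < 2 ^ k) a j =
  \sum_(0 <= j < 2 ^ k) cantor_length a k j.
Proof.
elim: k => [|k IH].
  by rewrite expn0 big_geq // big_nat1 subr0 cantor_length_root.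
rewrite {2}expnS mul2n sum_double (@big_cat_nat _ _ _ (2 ^ k)) /=; last 2 first.
- by rewrite expn_gt0.
- by rewrite leq_exp2l.
rewrite opprD addrA IH expnS mul2n -addnn (sum_nat_shift _ (2 ^ k)).
rewrite -sumrB !big_nat; apply: eq_bigr => j /andP[_ jk].
by rewrite (cantor_length_split jk); ring.
Qed.

End Cantor.

(** * Assouad exponents and the decay of the Cantor intervals *)

Section Growth.
Context {R : realType}.
Implicit Types (a : nat -> R) (al tau x y r S : R) (E : set R).

(** The number of intervals into which one interval splits in [n] steps, compared
    with the ratio of their lengths. *)
Definition cantor_growth a al := exists C : R, exists k0 : nat, 0 < C /\
  forall k n, (k0 <= k)%N ->
    2 ^+ n <= C * (cantor_length a k 0 / cantor_length a (k + n) 0) `^ al.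

Lemma decreasing_le a i j :
  decreasing_terms a -> (0 < i)%N -> (i <= j)%N -> a j <= a i.
Proof.
move=> ad i0; elim: j => [|j IH]; first by case: i i0.
rewrite leq_eqVlt => /orP[/eqP ->//|]; rewrite ltnS => ij.
exact: le_trans (ad _ (leq_trans i0 ij)) (IH ij).
Qed.

Lemma natr_unbounded (x : R) : exists n : nat, x < n%:R.
Proof. by exists (Num.trunc x).+1; exact: truncnS_gt. Qed.

Section Doubling.
Variables (a : nat -> R) (tau : R).
Hypotheses (a0 : positive_terms a) (ad : decreasing_terms a).
Hypotheses (asum : summable_terms a) (tau1 : (1 : R) <= tau).
Hypothesis taua : forall n, (0 < n)%N -> a n <= tau * a (2 * n)%N.
Implicit Types (k n m i j : nat).

Let tau_gt0 : 0 < tau. Proof. exact: lt_le_trans tau1. Qed.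

Let A k := cantor_length a k 0.
Let L := total_length a.

Lemma cantor_length_le0 k j : (j < 2 ^ k)%N -> cantor_length a k j <= A k.
Proof.
move=> jk; apply: (cantor_length_le a0 asum jk) => n.
apply: le_trans (subtree_sum_le a0 asum n _); last by rewrite expn_gt0.
apply: ler_sum => i _; apply: ler_sum => l _; apply: decreasing_le => //.
- by rewrite -addnA ltn_addr // expn_gt0.
- by rewrite muln0 addn0 leq_add2r leq_addr.
Qed.

(** Gaps of one level differ by a factor of at most [tau], because their indices
    differ by a factor of at most 2. *)
Lemma cantor_length0_le k j :
  (j < 2 ^ k)%N -> A k <= tau * cantor_length a k j.
Proof.
move=> jk; apply: (cantor_length_le a0 asum) => [|n]; first by rewrite expn_gt0.
apply: (@le_trans _ _ (tau * subtree_sum a k j n)); last first.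
  by apply: ler_wpM2l; [exact: ltW | exact: subtree_sum_le].
rewrite /subtree_sum mulr_sumr; apply: ler_sum => i _.
rewrite mulr_sumr !big_nat; apply: ler_sum => l /andP[_ li].
rewrite muln0 addn0.
apply: (@le_trans _ _ (a (2 ^ (k + i))%N)).
  by apply: decreasing_le; rewrite ?expn_gt0 ?leq_addr.
apply: (le_trans (taua _)); first by rewrite expn_gt0.
rewrite ler_wpM2l //; first exact: ltW.
apply: decreasing_le => //; first by rewrite -addnA ltn_addr // expn_gt0.
rewrite mul2n -addnn -addnA leq_add2l.
have : (2 ^ i * j + 2 ^ i <= 2 ^ (k + i))%N.
  by rewrite addnC -mulnS addnC expnD leq_mul2l jk orbT.
by lia.
Qed.

Lemma cantor_length0_gt0 k : 0 < A k.
Proof. by apply: cantor_length_gt0 => //; rewrite expn_gt0. Qed.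

Lemma cantor_length0_split k :
  A k = A k.+1 + a (2 ^ k)%N + cantor_length a k.+1 1.
Proof. by rewrite /A (cantor_length_split a0 asum) ?expn_gt0 // addn0. Qed.

Lemma cantor_length0_lt k : A k.+1 < A k.
Proof.
have h1 : 0 < a (2 ^ k)%N by apply: a0; rewrite expn_gt0.
have h2 : 0 < cantor_length a k.+1 1.
  by apply: cantor_length_gt0 => //; rewrite expnS; have := expn_gt0 2 k; lia.
by rewrite (cantor_length0_split k); lra.
Qed.

Lemma cantor_length0_nonincreasing m n : (m <= n)%N -> A n <= A m.
Proof.
move=> /subnKC <-; elim: (n - m)%N => [|d IH]; first by rewrite addn0.
by rewrite addnS; apply: le_trans (ltW (cantor_length0_lt _)) IH.
Qed.

Lemma node_le_cantor_length0 k : a (2 ^ k)%N <= A k.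
Proof.
by have := @node_le_cantor_length _ _ a0 asum k 0; rewrite addn0 expn_gt0; exact.
Qed.

Lemma cantor_length0_step k : A k <= (2 + tau) * A k.+1.
Proof.
have h1 : cantor_length a k.+1 1 <= A k.+1.
  by apply: cantor_length_le0; rewrite expnS; have := expn_gt0 2 k; lia.
have h2 : a (2 ^ k)%N <= tau * A k.+1.
  apply: le_trans (taua _) _; first by rewrite expn_gt0.
  by rewrite ler_wpM2l -?expnS ?node_le_cantor_length0 // ltW.
by rewrite (cantor_length0_split k); lra.
Qed.

Lemma tail_le_cantor_length k :
  L - \sum_(1 <= j < 2 ^ k) a j <= (2 ^ k)%:R * A k.
Proof.
rewrite (sum_cantor_length a0 asum) big_mkord.
rewrite (_ : (2 ^ k)%:R * A k = \sum_(j < 2 ^ k) A k); last first.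
  by rewrite sumr_const card_ord mulr_natl.
by apply: ler_sum => j _; exact: cantor_length_le0.
Qed.

Lemma tail_ge_cantor_length k :
  (2 ^ k)%:R * A k <= tau * (L - \sum_(1 <= j < 2 ^ k) a j).
Proof.
rewrite (sum_cantor_length a0 asum) big_mkord mulr_sumr.
rewrite (_ : (2 ^ k)%:R * A k = \sum_(j < 2 ^ k) A k); last first.
  by rewrite sumr_const card_ord mulr_natl.
by apply: ler_sum => j _; exact: cantor_length0_le.
Qed.

Lemma total_length_ge0 : 0 <= L.
Proof. by apply: le_trans (le_partial_sum_total_length 0 a0 asum); rewrite big_geq. Qed.

(** The 2^k intervals of step [k] have comparable lengths and fit into an interval
    of fixed length. *)
Lemma cantor_length0_small (eps : R) : 0 < eps -> exists k, A k < eps.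
Proof.
move=> e0; have [k hk] := natr_unbounded (tau * L / eps); exists k.
have p0 : 0 <= \sum_(1 <= j < 2 ^ k) a j.
  by rewrite big_nat sumr_ge0 // => j /andP[/a0/ltW].
rewrite ltr_pdivrMr // in hk.
have h := tail_ge_cantor_length k.
have kk : k%:R <= (2 ^ k)%:R :> R by rewrite ler_nat ltnW // ltn_expl.
have Ak := cantor_length0_gt0 k.
have k0 : (0 : R) < (2 ^ k)%:R by rewrite ltr0n expn_gt0.
have h1 := ler_wpM2r (ltW e0) kk; have h2 := mulr_ge0 (ltW tau_gt0) p0.
rewrite -/L mulrBr in h.
by rewrite -(ltr_pM2l k0); lra.
Qed.

(** At the scale of the Cantor intervals of step [k], all complementary sets have
    covering numbers comparable to 2^k; comparing the steps [k] and [k + n] by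
    submultiplicativity transfers the exponent from [E] to the Cantor
    intervals. *)
Lemma cantor_growth_of_exponent E al : complementary_set a E ->
  assouad_exponent E al -> cantor_growth a al.
Proof.
move=> /(complementary_setP _ a0) [u [gs ->]].
move=> /assouad_exponent_elim [c [rho [c0 rho0 H]]].
have [|k0 Ak0] := @cantor_length0_small (rho / 2); first by rewrite divr_gt0.
have p2 : (0 : R) < 2 `^ al by rewrite powR_gt0.
have tau0 := tau_gt0.
exists (6 * tau * c * 2 `^ al), k0; split; first by rewrite !mulr_gt0.
move=> k n k0k; set m := (k + n)%N; rewrite -/(A k) -/(A m).
have Ak := cantor_length0_gt0 k; have Am := cantor_length0_gt0 m.
have Ak_le := cantor_length0_nonincreasing k0k.
have Amk : A m <= A k by apply: cantor_length0_nonincreasing; rewrite leq_addr.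
have k2 : (0 < 2 ^ k)%N by rewrite expn_gt0.
have m2 : (0 < 2 ^ m)%N by rewrite expn_gt0.
have [s [cs ss]] := gap_complement_cover a0 total_length_ge0 gs Ak k2.
have ss2 : (size s)%:R <= 2 * (2 ^ k)%:R :> R.
  apply: le_trans ss _; rewrite mulr_natl mulr2n lerD2r ler_pdivrMr //.
  exact: tail_le_cantor_length.
pose B := c * (2 * A k / A m) `^ al.
have B0 : 0 <= B by rewrite mulr_ge0 ?powR_ge0 // ltW.
have [|t [ct st]] := @covered_refine _ _ _ (A m) (A k) B s (@subset_refl _ _) B0 _ cs.
  move=> x Fx; apply: H => //; lra.
have amle j : (2 ^ m <= j)%N -> a j <= A m.
  by move=> mj; apply: le_trans (node_le_cantor_length0 m); exact: decreasing_le.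
have h1 := gap_complement_cover_ge a0 asum gs Am m2 amle ct.
have h2 := tail_ge_cantor_length m.
have h3 : (2 ^ m)%:R * A m <= 3 * tau * (size t)%:R * A m.
  apply: le_trans h2 (le_trans (ler_wpM2l (ltW tau0) h1) _).
  by rewrite le_eqVlt; apply/orP; left; apply/eqP; ring.
rewrite ler_pM2r // in h3.
have h4 : (2 ^ m)%:R <= 3 * tau * (B * (2 * (2 ^ k)%:R)).
  apply: le_trans h3 _; rewrite ler_pM2l; last by lra.
  by apply: le_trans st _; rewrite ler_wpM2l.
have k2R : (0 : R) < (2 ^ k)%:R by rewrite ltr0n.
rewrite -(ler_pM2l k2R) -natrX -natrM -expnD -/m.
apply: le_trans h4 _; rewrite /B -[2 * A k / A m]mulrA powRM ?divr_ge0 //; try exact: ltW.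
by rewrite le_eqVlt; apply/orP; left; apply/eqP; ring.
Qed.

(** There are [d] whole intervals between the two given ones, and each has length
    at least [A k / tau]. *)
Lemma cantor_interval_gap k j d : (j + d.+1 < 2 ^ k)%N ->
  cantor_right a k j + d%:R * (A k / tau) <= cantor_left a k (j + d.+1).
Proof.
elim: d => [|d IH] jd.
  by rewrite mul0r addr0 ltW // (cantor_interval_lt a0 asum) // addn1.
have jd' : (j + d.+1 < 2 ^ k)%N by lia.
have h1 := IH jd'.
have h2 : cantor_right a k (j + d.+1) < cantor_left a k (j + d.+2).
  by apply: (cantor_interval_lt a0 asum) => //; rewrite ltn_add2l.
have h3 : A k / tau <= cantor_length a k (j + d.+1).
  by rewrite ler_pdivrMr 1?mulrC ?cantor_length0_le.
rewrite /cantor_right in h2; rewrite -natr1 mulrDl mul1r; lra.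
Qed.

(** A ball of radius smaller than [A k] meets boundedly many intervals of step
    [k]. *)
Lemma cantor_index_close k i j x y S : (i < 2 ^ k)%N -> (j < 2 ^ k)%N ->
  cantor_left a k i <= x <= cantor_right a k i ->
  cantor_left a k j <= y <= cantor_right a k j ->
  `|x - y| <= S -> S < A k -> (i <= j + (Num.trunc tau).+2)%N.
Proof.
move=> ik jk /andP[x1 x2] /andP[y1 y2] /ler_normlP [_ xy] SA.
rewrite leqNgt; apply/negP => hlt; pose d := (i - j).-1.
have Ei : i = (j + d.+1)%N by rewrite /d; lia.
have Td : ((Num.trunc tau).+1 <= d)%N by rewrite /d; lia.
have := cantor_interval_gap (k := k) (j := j) (d := d); rewrite -Ei => /(_ ik) h.
have tau0 := tau_gt0.
have td : tau < d%:R by apply: lt_le_trans (truncnS_gt tau) _; rewrite ler_nat.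
have : A k <= d%:R * (A k / tau); last lra.
have Ak := cantor_length0_gt0 k.
by rewrite mulrC mulrAC ler_pdivlMr // ler_wpM2l // ltW.
Qed.

(** The scales [S] and [r] are replaced by the nearest Cantor lengths. A ball of
    radius [S] meets a bounded number of intervals of the corresponding step, and
    the descendants of these intervals cover it at scale [r]. *)
Lemma assouad_exponent_cantor_set al : 0 <= al ->
  cantor_growth a al -> assouad_exponent (cantor_set a) al.
Proof.
move=> al0 [C [k0 [C0 H]]].
pose M := (Num.trunc tau).+2.
have tau0 := tau_gt0; have tau2 : 0 < 2 + tau by lra.
have c0 : 0 < (2 * M).+1%:R * C * ((2 + tau) ^+ 2) `^ al.
  by rewrite !mulr_gt0 ?ltr0n // powR_gt0 // exprn_gt0.
apply: (assouad_exponent_intro c0 (cantor_length0_gt0 k0)) => r S x r0 rS Srho Cx.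
have exS : exists k, A k <= S.
  by have [|k /ltW] := @cantor_length0_small S; [lra | exists k].
have exr : exists k, A k <= r.
  by have [|k /ltW] := @cantor_length0_small r; [lra | exists k].
have [k' Ak'S k'min] := ex_minnP exS; have [m' Amr m'min] := ex_minnP exr.
have k0k' : (k0 < k')%N.
  rewrite ltnNge; apply/negP => /cantor_length0_nonincreasing h; move: Srho h; rewrite -/(A _); lra.
case: k' => [|k] // in Ak'S k'min k0k' *.
have SAk : S < A k by rewrite ltNge; apply/negP => /k'min; rewrite ltnn.
have km' : (k < m')%N.
  rewrite ltnNge; apply/negP => /cantor_length0_nonincreasing h; lra.
case: m' => [|m] // in Amr m'min km' *.
have rAm : r < A m by rewrite ltNge; apply/negP => /m'min; rewrite ltnn.
pose n := (m.+1 - k)%N; have Em : m.+1 = (k + n)%N by rewrite /n subnKC // ltnW.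
have [i ik xi] := (cantor_setP a0 asum x).1 Cx k.
exists [seq cantor_left a m.+1 j | j <- index_iota (2 ^ n * (i - M)) (2 ^ n * (i + M).+1)].
split.
  move=> y [Cy xy]; have [j jm yj] := (cantor_setP a0 asum y).1 Cy m.+1.
  pose l := (j %/ 2 ^ n)%N.
  have lk : (l < 2 ^ k)%N by rewrite /l ltn_divLR ?expn_gt0 // -expnD -Em.
  have yl : cantor_left a k l <= y <= cantor_right a k l.
    have [|] := @cantor_descendant_in _ _ a0 asum k n j; rewrite -?Em //.
    by move: yj => /andP[? ?] ? ?; apply/andP; split; lra.
  have h1 := cantor_index_close ik lk xi yl xy SAk.
  have h2 : (l <= i + M)%N.
    by apply: (cantor_index_close lk ik yl xi _ SAk); rewrite distrC.
  exists (cantor_left a m.+1 j).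
    apply: map_f; rewrite mem_index_iota.
    have h3 := leq_trunc_div j (2 ^ n); rewrite -/l in h3.
    have h4 : (j < l.+1 * 2 ^ n)%N by rewrite ltn_ceil // expn_gt0.
    apply/andP; split.
    - apply: leq_trans h3; rewrite mulnC leq_mul2r; apply/orP; right.
      by rewrite leq_subLR addnC.
    - by apply: leq_trans h4 _; rewrite mulnC leq_mul2l ltnS h2 orbT.
  have := cantor_length_le0 jm; move: yj; rewrite /cantor_right => /andP[? ?] ?.
  by rewrite ler_norml; apply/andP; split; lra.
rewrite size_map size_iota -mulnBr.
have h1 : 2 ^+ n <= C * ((2 + tau) ^+ 2 * (S / r)) `^ al.
  have k0k : (k0 <= k)%N by [].
  apply: le_trans (H k n k0k) _; rewrite -Em -/(A k) -/(A m.+1).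
  have Ak := cantor_length0_gt0 k; have Am := cantor_length0_gt0 m.+1.
  rewrite ler_wpM2l ?(ltW C0) //.
  apply: ge0_ler_powR => //.
  - by rewrite nnegrE divr_ge0 ?ltW.
  - by rewrite nnegrE mulr_ge0 ?divr_ge0 ?exprn_ge0 //; lra.
  have g1 := cantor_length0_step k; have g2 := cantor_length0_step m.
  have g3 : A k <= (2 + tau) * S.
    by apply: le_trans g1 _; rewrite ler_wpM2l // ltW.
  have g4 : r <= (2 + tau) * A m.+1 by lra.
  rewrite ler_pdivrMr // (_ : _ * A m.+1 =
    (2 + tau) * S * ((2 + tau) * A m.+1) / r); last by ring.
  rewrite ler_pdivlMr //.
  by apply: ler_pM => //; lra.
apply: (@le_trans _ _ ((2 * M).+1%:R * 2 ^+ n)).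
  have wM : ((i + M).+1 - (i - M) <= (2 * M).+1)%N by clear; lia.
  by rewrite -natrX -natrM ler_nat mulnC leq_mul2r wM orbT.
rewrite -!mulrA ler_wpM2l //; apply: le_trans h1 _.
by rewrite powRM ?exprn_ge0 ?divr_ge0 //; lra.
Qed.

End Doubling.
End Growth.

(** * A complementary set of dimension one *)

Section PowerComparison.
Context {R : realType}.
Implicit Types (x C be : R).

Lemma bernoulli_ineq x n : 0 <= x -> 1 + n%:R * x <= (1 + x) ^+ n.
Proof.
move=> x0; elim: n => [|n IH]; first by rewrite mul0r addr0 expr0.
have h1 : 0 <= 1 + x by lra.
rewrite exprS; apply: le_trans (ler_wpM2l h1 IH).
have h2 : 0 <= n%:R * x * x by rewrite !mulr_ge0.
by rewrite -natr1; lra.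
Qed.

(** Exponential growth detects the exponent, whatever the constant. *)
Lemma unbounded_power_comparison C be :
  (forall N : nat, exists2 n, (N <= n)%N & 2 ^+ n <= C * (2 ^+ n) `^ be) -> 1 <= be.
Proof.
move=> H; rewrite leNgt; apply/negP => be1.
pose h : R := 2 `^ (1 - be) - 1.
have h0 : 0 < h by rewrite subr_gt0; apply: powR_gt1; lra.
have [N hN] := natr_unbounded (C / h); rewrite ltr_pdivrMr // in hN.
have [n Nn] := H N.
have p0 : (0 : R) < 2 ^+ n by rewrite exprn_gt0.
have pb : (0 : R) < (2 ^+ n) `^ be by rewrite powR_gt0.
rewrite -ler_pdivrMr // -{1}(powRr1 (ltW p0)) -powRB ?(gt_eqF p0) ?implybT //.
have -> : (2 ^+ n) `^ (1 - be) = (1 + h) ^+ n :> R.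
  rewrite (_ : 1 + h = 2 `^ (1 - be)); last by rewrite /h; ring.
  rewrite -powR_mulrn // -powR_mulrn ?powR_ge0 //.
  by rewrite -!powRrM mulrC.
have := bernoulli_ineq n (ltW h0).
have : N%:R * h <= n%:R * h by rewrite ler_wpM2r ?ler_nat // ltW.
lra.
Qed.

End PowerComparison.

Section DecreasingSet.
Context {R : realType}.
Implicit Types (a : nat -> R) (al : R).

Definition tail_sum a n : R := total_length a - \sum_(1 <= i < n) a i.

Lemma tail_sumS a n : (0 < n)%N -> tail_sum a n = tail_sum a n.+1 + a n.
Proof. by move=> n0; rewrite /tail_sum big_nat_recr //=; ring. Qed.

Lemma tail_sum_ge0 a n : positive_terms a -> summable_terms a -> 0 <= tail_sum a n.
Proof. by move=> a0 asum; rewrite subr_ge0 le_partial_sum_total_length. Qed.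

Lemma tail_sum_nonincreasing a m n : positive_terms a ->
  (0 < m)%N -> (m <= n)%N -> tail_sum a n <= tail_sum a m.
Proof.
move=> a0 m0; elim: n => [|n IH]; first by case: m m0.
rewrite leq_eqVlt => /orP[/eqP ->//|]; rewrite ltnS => mn.
have n0 : (0 < n)%N by exact: leq_trans mn.
by apply: le_trans (IH mn); rewrite (tail_sumS _ n0) lerDl ltW // a0.
Qed.

Lemma tail_sum_small a eps : positive_terms a -> summable_terms a -> 0 < eps ->
  exists N, forall n, (N <= n)%N -> tail_sum a n < eps.
Proof.
move=> a0 asum e0.
have [[N [N0 hN]]|H] := pselect (exists N, (0 < N)%N /\ tail_sum a N < eps).
  exists N => n Nn; exact: le_lt_trans (tail_sum_nonincreasing a0 N0 Nn) hN.
have : total_length a <= total_length a - eps; last lra.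
apply: total_length_le => // -[|n]; last first.
  rewrite lerBrDl -lerBrDr leNgt; apply/negP => h; apply: H.
  by exists n.+1.
have : ~ tail_sum a 1 < eps by move=> h; apply: H; exists 1%N.
by rewrite /tail_sum !big_geq // => /negP; rewrite -leNgt; lra.
Qed.

Lemma decreasing_gap_system a : positive_terms a -> summable_terms a ->
  gap_system a (fun j => tail_sum a j.+1) (total_length a).
Proof.
move=> a0 asum; split; last first.
  move=> j j0; split; first exact: tail_sum_ge0.
  rewrite -tail_sumS // lerBlDr lerDl big_nat sumr_ge0 // => i /andP[i0 _].
  exact/ltW/a0.
move=> i j i0 j0; rewrite -!tail_sumS //.
case: ltngtP => // ij _; [right|left]; exact: tail_sum_nonincreasing.
Qed.

(** Between the gaps [n] and [2 n] of the decreasing arrangement there are [n]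
    points at comparable distances from their neighbours, so approximate arithmetic
    progressions of arbitrary length appear at arbitrarily small scales. *)
Lemma decreasing_set_exponent a (tau : R) al : positive_terms a ->
  decreasing_terms a -> summable_terms a -> 1 <= tau ->
  (forall n, (0 < n)%N -> a n <= tau * a (2 * n)%N) ->
  assouad_exponent
    (gap_complement a (fun j => tail_sum a j.+1) (total_length a)) al ->
  1 <= al.
Proof.
move=> a0 ad asum tau1 taua Eal.
have gs := decreasing_gap_system a0 asum.
have al0 : 0 <= al.
  apply: assouad_exponent_ge0 Eal.
  by exists (tail_sum a 2); apply: (gap_left_in_complement a0 gs (j := 1%N)).
have [c [rho [c0 rho0 H]]] := assouad_exponent_elim Eal.
have [N hN] := tail_sum_small a0 asum rho0.
apply: (@unbounded_power_comparison _ (c * (3 * tau) `^ al)) => M.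
exists (maxn M N); first exact: leq_maxl.
set p := maxn M N; pose n := (2 ^ p)%N.
have n0 : (0 < n)%N by rewrite expn_gt0.
have Nn : (N <= n)%N.
  by apply: leq_trans (leq_maxr M N) _; exact/ltnW/ltn_expl.
have a2n : 0 < a (2 * n)%N by apply: a0; rewrite muln_gt0.
pose r := a (2 * n)%N / 3; have r0 : 0 < r by rewrite divr_gt0.
pose S := tail_sum a n - tail_sum a (2 * n).
have SE : S = \sum_(n <= i < 2 * n) a i.
  rewrite /S /tail_sum (@big_cat_nat _ _ _ n _ (2 * n)) //=; last lia.
  by ring.
have S1 : n%:R * a (2 * n)%N <= S.
  rewrite SE mulr_natl -[X in _ *+ X](_ : (2 * n - n)%N = n); last lia.
  rewrite -sumr_const_nat !big_nat; apply: ler_sum => i /andP[ni i2n].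
  by apply: decreasing_le => //; [exact: leq_trans ni | exact: ltnW].
have S2 : S <= n%:R * (tau * a (2 * n)%N).
  rewrite SE mulr_natl -[X in _ *+ X](_ : (2 * n - n)%N = n); last lia.
  rewrite -sumr_const_nat !big_nat; apply: ler_sum => i /andP[ni i2n].
  by apply: le_trans (taua _ n0); apply: decreasing_le.
have n1 : 1 <= n%:R :> R by rewrite ler1n.
have rS : r < S by apply: lt_le_trans S1; rewrite /r; nra.
have Srho : S < rho.
  by have := hN n Nn; have := tail_sum_ge0 (2 * n) a0 asum; rewrite /S; lra.
pose E := gap_complement a (fun j => tail_sum a j.+1) (total_length a).
have inE j : (0 < j)%N -> E (tail_sum a j.+1).
  exact: (gap_left_in_complement a0 gs).
have Ex : E (tail_sum a (2 * n)).
  by have := inE (2 * n).-1; rewrite prednK ?muln_gt0 //; apply; lia.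
have [s [cs ss]] := H r S _ r0 rS Srho Ex.
have /choice [f fP] : forall j, exists y, (n <= j < 2 * n)%N ->
    y \in s /\ `|y - tail_sum a j.+1| <= r.
  move=> j; have [hj|] := boolP (n <= j < 2 * n)%N; last by exists 0.
  have [|y ys yj] := cs (tail_sum a j.+1); last by exists y.
  move/andP: hj => [nj j2n]; split; first by apply: inE; exact: leq_trans nj.
  have g1 : tail_sum a (2 * n) <= tail_sum a j.+1 by exact: tail_sum_nonincreasing.
  have g2 : tail_sum a j.+1 <= tail_sum a n.
    by apply: tail_sum_nonincreasing => //; exact: leqW.
  by rewrite ler_norml /S; apply/andP; split; lra.
have sep i j : (n <= i)%N -> (i < j)%N -> (j < 2 * n)%N -> f i != f j.
  move=> ni ij j2n; apply/eqP => fij.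
  have [|_] := fP i; first by rewrite ni (ltn_trans ij).
  have [|_] := fP j; first by rewrite (leq_trans ni (ltnW ij)).
  rewrite fij !ler_norml => /andP[? ?] /andP[? ?].
  have j0 : (0 < j)%N by exact: leq_trans ij.
  have g1 := tail_sumS a j0.
  have g2 : tail_sum a j <= tail_sum a i.+1 by exact: tail_sum_nonincreasing.
  have g3 : a (2 * n)%N <= a j by apply: decreasing_le => //; exact: ltnW.
  have r3 : a (2 * n)%N = 3 * r by rewrite /r; field.
  lra.
have ns : (n <= size s)%N.
  rewrite -[leqLHS](size_iota n n) -(size_map f); apply: uniq_leq_size.
    rewrite map_inj_in_uniq ?iota_uniq // => i j.
    rewrite !mem_iota addnn -mul2n => /andP[ni i2] /andP[nj j2] fij.
    case: (ltngtP i j) => // ij.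
    - by have := sep i j ni ij j2; rewrite fij eqxx.
    - by have := sep j i nj ij i2; rewrite fij eqxx.
  move=> y /mapP [i]; rewrite mem_iota addnn -mul2n => hi ->.
  by have [] := fP i hi.
have <- : n%:R = 2 ^+ p :> R by rewrite natrX.
apply: le_trans (le_trans ss _); first by rewrite ler_nat.
rewrite -mulrA ler_wpM2l ?(ltW c0) // -powRM //; last lra.
apply: ge0_ler_powR => //; rewrite ?nnegrE ?divr_ge0 ?mulr_ge0 //; try lra.
rewrite ler_pdivrMr //; apply: le_trans S2 _.
by rewrite /r le_eqVlt; apply/orP; left; apply/eqP; field.
Qed.

End DecreasingSet.

(** * Splitting a sequence into two subsequences *)

Definition positive_inj (sg : nat -> nat) := forall m n,
  (0 < m)%N -> (0 < n)%N -> sg m = sg n -> m = n.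

Definition index_splitting (sg sg' : nat -> nat) :=
  [/\ forall n, (0 < n)%N -> (0 < sg n)%N /\ (0 < sg' n)%N,
      positive_inj sg, positive_inj sg',
      forall m n, (0 < m)%N -> (0 < n)%N -> sg m <> sg' n
    & forall j, (0 < j)%N -> (exists2 n, (0 < n)%N & j = sg n) \/
                             (exists2 n, (0 < n)%N & j = sg' n)].

(** At least half of the indices up to any bound stay free, so the increasing
    enumeration of the free indices grows at most like [2 n]. It is obtained by
    inverting the counting function of the free indices. *)
Section ComplementEnumeration.
Variable sg : nat -> nat.
Hypothesis sg_ge : forall n, (0 < n)%N -> (2 * n <= sg n)%N.
Hypothesis sg_inj : positive_inj sg.

(* Since sg n >= n, the preimages of j are among 1, ..., j. *)
Let taken j := j \in [seq sg n | n <- iota 1 j].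

Let takenP j : (0 < j)%N -> reflect (exists2 n, (0 < n)%N & j = sg n) (taken j).
Proof.
move=> j0; apply: (iffP mapP) => [[n]|[n n0 jn]].
  by rewrite mem_iota => /andP[n0 _] ->; exists n.
by exists n => //; rewrite mem_iota n0 /= jn; have := sg_ge n0; lia.
Qed.

Let free_count m := count (predC taken) (iota 1 m).

Let free_countS m : free_count m.+1 = (free_count m + ~~ taken m.+1)%N.
Proof. by rewrite /free_count -[m.+1]addn1 iotaD count_cat /= addn0 add1n addn1. Qed.

Let free_count_le m : (free_count m <= m)%N.
Proof. by rewrite -{2}(size_iota 1 m) count_size. Qed.

Let free_count_mono m n : (m <= n)%N -> (free_count m <= free_count n)%N.
Proof. by move=> mn; rewrite /free_count -(subnKC mn) iotaD count_cat leq_addr. Qed.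

Let free_count_ge n : (n <= free_count (2 * n))%N.
Proof.
have h : (count taken (iota 1 (2 * n)) <= n)%N.
  rewrite -size_filter -[leqRHS](size_iota 1 n) -[leqRHS](size_map sg).
  apply: uniq_leq_size; first by rewrite filter_uniq // iota_uniq.
  move=> j; rewrite mem_filter mem_iota => /andP[+ /andP[j0 j2n]].
  move=> /(takenP j0) [k k0 jk]; rewrite jk map_f // mem_iota k0 /=.
  by have := sg_ge k0; lia.
have := count_predC taken (iota 1 (2 * n)); rewrite size_iota.
by rewrite -/(free_count _); lia.
Qed.

Let exists_free n : exists m, (n <= free_count m)%N.
Proof. by exists (2 * n)%N; exact: free_count_ge. Qed.

Let free n := ex_minn (exists_free n).

Let freeP n : (0 < n)%N ->
  [/\ (0 < free n)%N, ~~ taken (free n) & free_count (free n) = n].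
Proof.
move=> n0; rewrite /free; case: ex_minnP => -[|m] nm min_m.
  by move: nm; rewrite /free_count /=; lia.
have hm : (free_count m < n)%N.
  by rewrite ltnNge; apply/negP => /min_m; rewrite ltnn.
by move: nm; rewrite free_countS; case: (taken m.+1) => /= ?; split=> //; lia.
Qed.

Lemma complement_enumeration : exists sg', index_splitting sg sg' /\
  [/\ forall n, (n <= sg' n <= 2 * n)%N &
      forall m n, (m <= n)%N -> (sg' m <= sg' n)%N].
Proof.
have free_min n m : (n <= free_count m)%N -> (free n <= m)%N.
  by rewrite /free; case: ex_minnP => ? _; apply.
have free_ge n : (n <= free_count (free n))%N.
  by rewrite /free; case: ex_minnP.
exists free; split; last split.
- split.
  + move=> n n0; have [? _ _] := freeP n0; split=> //.
    by apply: leq_trans (sg_ge n0); rewrite muln_gt0.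
  + exact: sg_inj.
  + move=> m n m0 n0 mn; have [_ _ <-] := freeP m0; have [_ _ <-] := freeP n0.
    by rewrite mn.
  + move=> m n m0 n0 mn; have [f0 /(takenP f0) nt _] := freeP n0.
    by apply: nt; exists m.
  + move=> j j0; have [/(takenP j0)|nt] := boolP (taken j); [by left|right].
    have Ej : free_count j = (free_count j.-1).+1.
      by rewrite -{1}(prednK j0) free_countS (prednK j0) nt addn1.
    have c0 : (0 < free_count j)%N by rewrite Ej.
    exists (free_count j) => //; apply/eqP; rewrite eqn_leq free_min // andbT.
    rewrite leqNgt; apply/negP => hlt.
    have h : (free (free_count j) <= j.-1)%N by lia.
    have [_ _] := freeP c0; have := free_count_mono h; lia.
- move=> n; apply/andP; split; first exact: leq_trans (free_ge n) (free_count_le _).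
  exact/free_min/free_count_ge.
- move=> m n mn; apply: free_min; exact: leq_trans mn (free_ge n).
Qed.

End ComplementEnumeration.

Section Concatenation.
Context {R : realType}.
Implicit Types (a b : nat -> R) (E : set R).

Lemma sum_uniq_le_total_length a (s : seq nat) :
  positive_terms a -> summable_terms a -> uniq s ->
  (forall j, j \in s -> (0 < j)%N) -> \sum_(j <- s) a j <= total_length a.
Proof.
move=> a0 asum us s0; pose N := (\max_(j <- s) j).+1.
have sN j : j \in s -> j \in index_iota 1 N.
  by move=> js; rewrite mem_index_iota s0 // ltnS; exact: (leq_bigmax_seq (F := id)).
apply: le_trans (le_partial_sum_total_length N a0 asum).
have -> : \sum_(j <- s) a j = \sum_(j <- [seq j <- index_iota 1 N | j \in s]) a j.
  apply/perm_big/uniq_perm => //; first by rewrite filter_uniq // iota_uniq.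
  by move=> j; rewrite mem_filter; have [/sN|] := boolP (j \in s).
rewrite big_filter [leRHS](bigID (fun j => j \in s)) /= lerDl.
by rewrite big_nat_cond sumr_ge0 // => j /andP[/andP[/a0/ltW]].
Qed.

Lemma summable_comparison a b : positive_terms a -> summable_terms a ->
  positive_terms b -> (forall n, (0 < n)%N -> b n <= a n) -> summable_terms b.
Proof.
move=> a0 asum b0 ba; apply: nondecreasing_is_cvgn.
  apply/nondecreasing_seqP => -[|m]; first by rewrite !big_geq.
  by rewrite [leRHS]big_nat_recr //= lerDl ltW // b0.
exists (total_length a) => _ [n _ <-].
apply: le_trans (le_partial_sum_total_length n a0 asum).
by rewrite !big_nat; apply: ler_sum => j /andP[j0 _]; exact: ba.
Qed.

Section Splitting.
Variables (a : nat -> R) (sg sg' : nat -> nat).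
Hypotheses (a0 : positive_terms a) (asum : summable_terms a).
Hypothesis split_sg : index_splitting sg sg'.
Let b := a \o sg.
Let b' := a \o sg'.
Hypotheses (bsum : summable_terms b) (bsum' : summable_terms b').

Let b0 : positive_terms b.
Proof. by move=> n n0; apply: a0; case: split_sg => /(_ n n0) []. Qed.

Let b0' : positive_terms b'.
Proof. by move=> n n0; apply: a0; case: split_sg => /(_ n n0) []. Qed.

(** Both inequalities compare finite partial sums of one side, reindexed by the
    splitting, with the total on the other side. *)
Lemma total_length_splitting :
  total_length a = total_length b + total_length b'.
Proof.
have [sg0 inj inj' disj cov] := split_sg.
apply: le_anti; apply/andP; split.
  have /choice [g gP] : forall j, exists n, (exists2 n', (0 < n')%N & j = sg n') ->
      (0 < n)%N /\ j = sg n.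
    move=> j; have [[n n0 jn]|h] := pselect (exists2 n', (0 < n')%N & j = sg n').
      by exists n.
    by exists 0%N.
  have /choice [g' gP'] : forall j, exists n, (exists2 n', (0 < n')%N & j = sg' n') ->
      (0 < n)%N /\ j = sg' n.
    move=> j; have [[n n0 jn]|h] := pselect (exists2 n', (0 < n')%N & j = sg' n').
      by exists n.
    by exists 0%N.
  pose P j := (0 < g j)%N && (j == sg (g j)).
  apply: total_length_le => // N; rewrite (bigID P) /= -big_filter -[X in _ + X]big_filter.
  have part (s : seq nat) f h : uniq s -> (forall j, j \in s -> (0 < f j)%N /\ j = h (f j)) ->
      positive_terms (a \o h) -> summable_terms (a \o h) ->
      \sum_(j <- s) a j <= total_length (a \o h).
    move=> us sP h0 hsum.
    apply: le_trans (@sum_uniq_le_total_length _ [seq f j | j <- s] h0 hsum _ _).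
    - rewrite big_map le_eqVlt; apply/orP; left.
      by apply/eqP/eq_big_seq => j /sP [_ /= <-].
    - rewrite map_inj_in_uniq // => i j /sP [_ Ei] /sP [_ Ej] fij.
      by rewrite Ei Ej fij.
    - by move=> n /mapP [j /sP [f0 _] ->].
  apply: lerD; [apply: (part _ g) => //|apply: (part _ g') => //].
  - by rewrite filter_uniq // iota_uniq.
  - by move=> j; rewrite mem_filter => /andP[/andP[? /eqP ?] _].
  - by rewrite filter_uniq // iota_uniq.
  - move=> j; rewrite mem_filter mem_index_iota => /andP[nP /andP[j0 _]].
    have [h|h] := cov j j0; last exact: gP'.
    by have [h1 h2] := gP j h; rewrite /P h1 -h2 eqxx in nP.
rewrite -lerBrDr; apply: total_length_le => // M.
rewrite lerBrDr addrC -lerBrDr; apply: total_length_le => // N; rewrite lerBrDr.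
rewrite -(big_map sg' predT) -(big_map sg predT) -big_cat /=.
apply: sum_uniq_le_total_length => //.
  rewrite cat_uniq !map_inj_in_uniq ?iota_uniq ?andbT /=.
  - apply/hasPn => j /mapP [n]; rewrite mem_index_iota => /andP[n0 _] ->.
    apply/negP => /mapP [m]; rewrite mem_index_iota => /andP[m0 _].
    exact: disj.
  - by move=> m n; rewrite !mem_index_iota => /andP[? _] /andP[? _]; exact: inj.
  - by move=> m n; rewrite !mem_index_iota => /andP[? _] /andP[? _]; exact: inj'.
move=> j; rewrite mem_cat => /orP[] /mapP [n]; rewrite mem_index_iota => /andP[n0 _] ->;
  by have [] := sg0 n n0.
Qed.

(** Complementary sets of the two subsequences, placed side by side. *)
Lemma complementary_set_concatenation E1 E2 :
  complementary_set b E1 -> complementary_set b' E2 ->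
  exists E, [/\ complementary_set a E, E1 `<=` E &
    E `<=` E1 `|` [set y | E2 (y - total_length b)]].
Proof.
have [sg0 inj inj' disj cov] := split_sg.
move=> /(complementary_setP _ b0) [u [[sep u0L] ->]].
move=> /(complementary_setP _ b0') [u' [[sep' u0L'] ->]].
have LE := total_length_splitting.
have L0 : 0 <= total_length b.
  by apply: le_trans (le_partial_sum_total_length 0 b0 bsum); rewrite big_geq.
have L0' : 0 <= total_length b'.
  by apply: le_trans (le_partial_sum_total_length 0 b0' bsum'); rewrite big_geq.
have /choice [v vP] : forall j, exists x, (0 < j)%N ->
    (exists n, [/\ (0 < n)%N, j = sg n & x = u n]) \/
    (exists n, [/\ (0 < n)%N, j = sg' n & x = total_length b + u' n]).
  move=> j; have [->|j0] := posnP j; first by exists 0.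
  have [[n n0 jn]|[n n0 jn]] := cov j j0.
    by exists (u n) => _; left; exists n.
  by exists (total_length b + u' n) => _; right; exists n.
have v1 n : (0 < n)%N -> v (sg n) = u n.
  move=> n0; have [|[m [m0 mn ->]]|[m [m0 mn _]]] := vP (sg n).
  - by have [] := sg0 n n0.
  - by congr u; apply: inj.
  - by case: (disj n m n0 m0 mn).
have v2 n : (0 < n)%N -> v (sg' n) = total_length b + u' n.
  move=> n0; have [|[m [m0 mn _]]|[m [m0 mn ->]]] := vP (sg' n).
  - by have [] := sg0 n n0.
  - by case: (disj m n m0 n0); rewrite mn.
  - by congr (_ + u' _); apply: inj'.
exists (gap_complement a v (total_length a)); split.
- apply/(complementary_setP _ a0); exists v; split=> //; split; last first.
    move=> j j0; rewrite LE; have [[n n0 ->]|[n n0 ->]] := cov j j0.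
      by rewrite v1 //; have := u0L n n0; rewrite /b /= => -[? ?]; split; lra.
    by rewrite v2 //; have := u0L' n n0; rewrite /b' /= => -[? ?]; split; lra.
  move=> i j i0 j0; have [[m m0 ->]|[m m0 ->]] := cov i i0;
    have [[n n0 ->]|[n n0 ->]] := cov j j0 => ij.
  + rewrite !v1 //; apply: sep => //.
    by apply: contraNneq ij => ->.
  + rewrite v1 // v2 //; left.
    have := u0L m m0; have := u0L' n n0; rewrite /b /b' /= => -[? ?] [? ?]; lra.
  + rewrite v1 // v2 //; right.
    have := u0L n n0; have := u0L' m m0; rewrite /b /b' /= => -[? ?] [? ?]; lra.
  + rewrite !v2 //; have [|h|h] := sep' m n m0 n0.
    * by apply: contraNneq ij => ->.
    * by left; rewrite /b' /= in h; lra.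
    * by right; rewrite /b' /= in h; lra.
- move=> y [/andP[y0 yL] yu]; split; first by rewrite LE; apply/andP; split; lra.
  move=> j j0; have [[n n0 ->]|[n n0 ->]] := cov j j0.
    by rewrite v1 //; exact: yu.
  rewrite v2 //; have [? ?] := u0L' n n0.
  by rewrite negb_and -leNgt; apply/orP; left; lra.
move=> y [/andP[y0 yL] yv].
have [yb|yb'] := leP y (total_length b); [left|right].
  split; first by rewrite y0.
  by move=> n n0; have := yv (sg n); rewrite v1 //; apply; have [] := sg0 n n0.
split; first by rewrite LE in yL; apply/andP; split; lra.
move=> n n0; have := yv (sg' n); rewrite v2 // => h.
have := h (sg0 n n0).2; apply: contra => /andP[]; rewrite /b' /= => ? ?.
by apply/andP; split; lra.
Qed.

End Splitting.
End Concatenation.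

(** * Subsequences with prescribed decay *)

(** Dyadic blocks of steps are alternately fast and slow. The slow blocks are
    arbitrarily long, and yet at least a quarter of the steps up to any bound are
    fast. *)
Definition fast j := ~~ odd (trunc_log 2 j).
Definition fast_count k := count fast (iota 0 k).

Lemma fast_countD m n : fast_count (m + n) = (fast_count m + count fast (iota m n))%N.
Proof. by rewrite /fast_count iotaD count_cat add0n. Qed.

Lemma fast_count_mono m n : (m <= n)%N -> (fast_count m <= fast_count n)%N.
Proof. by move=> mn; rewrite -(subnKC mn) fast_countD leq_addr. Qed.

Lemma count_fast_block p m n : (2 ^ p <= m)%N -> (m + n <= 2 ^ p.+1)%N ->
  count fast (iota m n) = if odd p then 0%N else n.
Proof.
move=> pm mn.
rewrite (@eq_in_count _ fast (fun=> ~~ odd p)); last first.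
  move=> j; rewrite mem_iota => /andP[h1 h2].
  by rewrite /fast (@trunc_log_eq 2 p) //; lia.
by case: (odd p) => /=; [rewrite count_pred0 | rewrite count_predT size_iota].
Qed.

Lemma fast_count_plateau p n : odd p -> (n <= 2 ^ p)%N ->
  fast_count (2 ^ p + n) = fast_count (2 ^ p).
Proof.
move=> op np; rewrite fast_countD (@count_fast_block p) ?op ?addn0 //.
by rewrite expnS; lia.
Qed.

Lemma fast_count_ge k : (k <= 4 * fast_count k)%N.
Proof.
have [->//|k0] := posnP k.
have /andP[] := trunc_log_bounds (isT : 1 < 2)%N k0.
set p := trunc_log 2 k; rewrite expnS => pk kp.
have Ek : k = (2 ^ p + (k - 2 ^ p))%N by rewrite subnKC.
have block q : ~~ odd q -> (2 ^ q <= fast_count (2 ^ q.+1))%N.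
  move=> oq; rewrite expnS mul2n -addnn fast_countD (@count_fast_block q) //.
    by rewrite (negbTE oq) leq_addl.
  by rewrite expnS; lia.
have [op|ep] := boolP (odd p).
  case: p op pk kp Ek => // q /= oq pk kp Ek.
  have h := block q oq; have h2 := fast_count_mono pk.
  by rewrite expnS in pk kp; lia.
have h3 : fast_count k = (fast_count (2 ^ p) + (k - 2 ^ p))%N.
  rewrite {1}Ek fast_countD (@count_fast_block p) //; first by rewrite (negbTE ep).
  by rewrite expnS; lia.
case: p ep pk kp Ek h3 => [|[|q]] /= ep pk kp Ek h3; rewrite ?negbK in ep.
- have -> : k = 1%N by rewrite expn0 in pk kp; lia.
  by [].
- by [].
- have h := block q ep; have h2 : (fast_count (2 ^ q.+1) <= fast_count (2 ^ q.+2))%N.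
    by apply: fast_count_mono; rewrite leq_exp2l.
  by rewrite !expnS in pk kp h h2 h3 Ek *; lia.
Qed.

Section Sparse.
Context {R : realType}.
Implicit Types (al x y : R).

Lemma geometric_sum_le (x : R) n : 0 <= x -> x < 1 ->
  \sum_(0 <= i < n) x ^+ i <= (1 - x)^-1.
Proof.
move=> x0 x1; have h : \sum_(0 <= i < n) x ^+ i = (1 - x ^+ n) / (1 - x).
  elim: n => [|n IH]; first by rewrite big_geq // expr0 subrr mul0r.
  by rewrite big_nat_recr //= IH exprS; field; lra.
have x1' : 0 < 1 - x by lra.
rewrite h ler_pdivrMr // mulVf ?gt_eqF // lerBlDr lerDl exprn_ge0 //.
Qed.

(** Comparable sequences have comparable Cantor intervals, and the growth condition
    only sees these up to constants. *)
Lemma cantor_growth_comparison (a b : nat -> R) (tau : R) al :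
  positive_terms a -> summable_terms a -> positive_terms b -> summable_terms b ->
  1 <= tau -> (forall n, (0 < n)%N -> b n <= a n /\ a n <= tau * b n) -> 0 <= al ->
  cantor_growth a al -> cantor_growth b al.
Proof.
move=> a0 asum b0 bsum tau1 ab al0 [C [k0 [C0 H]]].
have tau0 : 0 < tau by lra.
exists (C * tau `^ al), k0; split; first by rewrite mulr_gt0 // powR_gt0.
have k2 k : (0 < 2 ^ k)%N by rewrite expn_gt0.
have node k i l : (0 < 2 ^ (k + i) + 2 ^ i * 0 + l)%N.
  by rewrite -addnA ltn_addr.
have ba k : cantor_length b k 0 <= cantor_length a k 0.
  apply: (cantor_length_le b0 bsum) => // n.
  apply: le_trans (subtree_sum_le a0 asum n (k2 k)).
  apply: ler_sum => i _; apply: ler_sum => l _.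
  by have [] := ab _ (node k i l).
have atb k : cantor_length a k 0 <= tau * cantor_length b k 0.
  apply: (cantor_length_le a0 asum) => // n.
  apply: le_trans (ler_wpM2l (ltW tau0) (subtree_sum_le b0 bsum n (k2 k))).
  rewrite /subtree_sum mulr_sumr; apply: ler_sum => i _.
  rewrite mulr_sumr; apply: ler_sum => l _.
  by have [] := ab _ (node k i l).
move=> k n k0k; apply: le_trans (H k n k0k) _.
rewrite -mulrA ler_wpM2l ?(ltW C0) //.
have A0 j : 0 <= cantor_length a j 0 by apply/ltW/cantor_length_gt0.
have B0 j : 0 < cantor_length b j 0 by exact: cantor_length_gt0.
have B0' j : 0 <= cantor_length b j 0 by exact: ltW.
rewrite -powRM ?divr_ge0 ?(ltW tau0) //.
apply: ge0_ler_powR; rewrite ?nnegrE ?mulr_ge0 ?invr_ge0 ?(ltW tau0) //.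
rewrite mulrA; apply: ler_pM; rewrite ?invr_ge0 //.
by rewrite lef_pV2 ?posrE ?cantor_length_gt0.
Qed.

Section Decay.
Variables (a : nat -> R) (tau s : R).
Hypotheses (a0 : positive_terms a) (ad : decreasing_terms a).
Hypotheses (asum : summable_terms a) (tau1 : 1 <= tau).
Hypothesis taua : forall n, (0 < n)%N -> a n <= tau * a (2 * n)%N.
Hypotheses (s0 : 0 < s) (s1 : s < 1).
Implicit Types (k n m i j : nat).

Let tau0 : 0 < tau. Proof. exact: lt_le_trans tau1. Qed.

Let q : R := 2 `^ (- s^-1).
Let D : R := tau ^- 4.

Let q0 : 0 < q. Proof. by rewrite powR_gt0. Qed.

Let D0 : 0 < D. Proof. by rewrite invr_gt0 exprn_gt0. Qed.

Let D1 : D <= 1.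
Proof. by rewrite invf_le1 ?exprn_gt0 // exprn_ege1. Qed.

Let q2 : 2 * q < 1.
Proof.
have h : 1 < 2 `^ (s^-1 - 1) :> R.
  by apply: powR_gt1; [rewrite ltr1n | rewrite subr_gt0 invf_gt1].
have -> : 2 * q = (2 `^ (s^-1 - 1))^-1.
  rewrite -powRN opprB powRD ?pnatr_eq0 ?implybT // powRr1 //.
by rewrite invf_lt1 // (lt_trans ltr01).
Qed.

Let c : R := a 1%N / (2 * tau).

Let c0 : 0 < c. Proof. by rewrite divr_gt0 ?mulr_gt0 // a0. Qed.

(** The intended gap length at step [k]: it shrinks by the factor [q], as for a
    self-similar set of dimension [s], and by a further factor [D] at the fast
    steps. *)
Definition target k : R := c * q ^+ k * D ^+ fast_count k.

Let target_gt0 k : 0 < target k.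
Proof. by rewrite /target mulr_gt0 ?exprn_gt0 // mulr_gt0 ?exprn_gt0. Qed.

Let targetD k n : target (k + n) <= q ^+ n * target k.
Proof.
rewrite /target fast_countD !exprD.
set x := q ^+ k; set y := q ^+ n; set z := D ^+ fast_count k.
rewrite (_ : y * (c * x * z) = c * (x * y) * (z * 1)); last by ring.
have xyz : 0 <= c * (x * y).
  by apply/ltW/mulr_gt0 => //; apply: mulr_gt0; exact: exprn_gt0.
rewrite ler_wpM2l // ler_wpM2l ?exprn_ge0 ?(ltW D0) //.
by rewrite exprn_ile1 // ltW.
Qed.

Let target_plateau p n : odd p -> (n <= 2 ^ p)%N ->
  target (2 ^ p + n) = q ^+ n * target (2 ^ p).
Proof.
by move=> op np; rewrite /target fast_count_plateau // exprD; ring.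
Qed.

Let targetS k : q * D * target k <= target k.+1.
Proof.
rewrite /target -[in X in _ <= X](addn1 k) fast_countD addn1 exprD exprS.
set x := q ^+ k; set z := D ^+ fast_count k.
rewrite (_ : q * D * (c * x * z) = c * (q * x) * (z * D)); last by ring.
have xyz : 0 <= c * (q * x).
  by apply/ltW/mulr_gt0 => //; apply: mulr_gt0 => //; exact: exprn_gt0.
rewrite ler_wpM2l // ler_wpM2l ?exprn_ge0 ?(ltW D0) //=.
by rewrite addn0; case: (fast k); rewrite ?expr1 // expr0.
Qed.

Let q1 : q <= 1.
Proof. by have := q2; have := q0 => h1 h2; lra. Qed.

Let target_nonincreasing k n : (k <= n)%N -> target n <= target k.
Proof.
move=> kn; rewrite -(subnKC kn); apply: le_trans (targetD _ _) _.
rewrite -[leRHS]mul1r ler_wpM2r ?(ltW (target_gt0 _)) //.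
by rewrite exprn_ile1 // ltW.
Qed.

Let level_ge k : a 1%N <= tau ^+ k * a (2 ^ k)%N.
Proof.
elim: k => [|k IH]; first by rewrite expr0 mul1r.
apply: le_trans IH _; rewrite exprSr -mulrA ler_wpM2l ?exprn_ge0 ?(ltW tau0) //.
by rewrite expnS; apply: taua; rewrite expn_gt0.
Qed.

(** The sequence [a] shrinks by at most [tau] per level, whereas [D] is [tau ^- 4]
    and acts on at least a quarter of the steps. This makes room in the level
    [source_level k] of [a] for the whole step [k] of the subsequence, with gaps to
    spare for the complement. *)
Let target_lt k : target k < a (2 ^ k.+1)%N.
Proof.
have t0 := tau0; have t1 : 1 <= tau := tau1.
have qk : q ^+ k <= 1 by rewrite exprn_ile1 // ltW.
have Dk : D ^+ fast_count k <= tau ^- k.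
  rewrite /D -exprVn -exprM -[leRHS]exprVn.
  by apply: ler_wiXn2l; [rewrite invr_ge0 ltW | rewrite invf_le1 | exact: fast_count_ge].
have a1 : 0 < a 1%N by exact: a0.
have tk : 0 < tau ^+ k by rewrite exprn_gt0.
have h := level_ge k.+1; rewrite exprS in h.
apply: (@le_lt_trans _ _ (c * tau ^- k)).
  rewrite /target; apply: ler_pM => //.
  - by rewrite mulr_ge0 ?exprn_ge0 // ltW.
  - by rewrite exprn_ge0 // ltW.
  - by rewrite -[leRHS]mulr1 ler_wpM2l // ltW.
rewrite ltr_pdivrMr // /c ltr_pdivrMr; last by rewrite mulr_gt0.
apply: (@lt_le_trans _ _ (2 * a 1%N)); first lra.
by move: h; set z := a _ => h; lra.
Qed.

Let exists_level k : exists K, a (2 ^ K)%N <= target k.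
Proof.
have [K hK] := cantor_length0_small a0 ad asum tau1 taua (target_gt0 k).
exists K; apply: le_trans (ltW hK); exact: node_le_cantor_length0.
Qed.

(** The first level of [a] whose gaps are as short as [target k]; by doubling they
    are not much shorter. *)
Definition source_level k := ex_minn (exists_level k).

Let source_le k : a (2 ^ source_level k)%N <= target k.
Proof. by rewrite /source_level; case: ex_minnP. Qed.

Let source_min k K : a (2 ^ K)%N <= target k -> (source_level k <= K)%N.
Proof. by rewrite /source_level; case: ex_minnP => ? _; apply. Qed.

Let source_ge k : (k.+2 <= source_level k)%N.
Proof.
rewrite ltnNge; apply/negP => h.
have := le_lt_trans (source_le k) (target_lt k); apply/negP; rewrite -leNgt.
by apply: decreasing_le; rewrite ?expn_gt0 // leq_exp2l.
Qed.

Let source_mono k n : (k <= n)%N -> (source_level k <= source_level n)%N.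
Proof.
move=> kn; apply: source_min.
exact: le_trans (source_le n) (target_nonincreasing kn).
Qed.

Let source_gt k : target k < tau ^+ 2 * a (2 ^ (source_level k).+1)%N.
Proof.
have := source_ge k; case E: (source_level k) => [//|K] _.
apply: (@lt_le_trans _ _ (a (2 ^ K)%N)).
  by rewrite ltNge; apply/negP => /source_min; rewrite E ltnn.
apply: (le_trans (taua _)); first by rewrite expn_gt0.
rewrite expr2 -mulrA ler_wpM2l ?(ltW tau0) // -expnS.
apply: (le_trans (taua _)); first by rewrite expn_gt0.
by rewrite -expnS.
Qed.

(** Since [n < 2 ^ (k + 1)] at step [k] and [source_level k >= k + 2], adding [n] to
    the first index of the level stays in the level, and keeps the indices
    distinct when consecutive steps share a level. *)
Definition sparse_index n := (2 ^ source_level (trunc_log 2 n) + n)%N.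

Let sparse_bounds k n : (2 ^ k <= n < 2 ^ k.+1)%N ->
  a (sparse_index n) <= target k /\ target k < tau ^+ 2 * a (sparse_index n).
Proof.
move=> kn; rewrite /sparse_index (trunc_log_eq _ kn) //.
have /andP[_ n2] := kn; have sk := source_ge k.
have K2 : (2 ^ k.+1 <= 2 ^ source_level k)%N by rewrite leq_exp2l // ltnW.
split.
  by apply: le_trans (source_le k); apply: decreasing_le; rewrite ?expn_gt0 ?leq_addr.
apply: lt_le_trans (source_gt k) _; rewrite ler_wpM2l ?exprn_ge0 ?(ltW tau0) //.
by apply: decreasing_le; rewrite ?expnS ?addn_gt0 ?expn_gt0 //; lia.
Qed.

Lemma sparse_index_ge n : (0 < n)%N -> (2 * n <= sparse_index n)%N.
Proof.
move=> n0; have /andP[_ h] := trunc_log_bounds (isT : 1 < 2)%N n0.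
rewrite /sparse_index; have h2 := source_ge (trunc_log 2 n).
have : (2 ^ (trunc_log 2 n).+1 <= 2 ^ source_level (trunc_log 2 n))%N.
  by rewrite leq_exp2l // ltnW.
by lia.
Qed.

Lemma sparse_index_lt m n : (m < n)%N -> (sparse_index m < sparse_index n)%N.
Proof.
move=> mn; rewrite /sparse_index -addnS leq_add // leq_exp2l //.
by apply: source_mono; apply: leq_trunc_log; exact: ltnW.
Qed.

Lemma sparse_index_inj : positive_inj sparse_index.
Proof.
move=> m n _ _ mn; case: (ltngtP m n) => // /sparse_index_lt; by rewrite mn ltnn.
Qed.

Let b := a \o sparse_index.

Let b0 : positive_terms b.
Proof. by move=> n n0; apply: a0; rewrite /sparse_index addn_gt0 n0 orbT. Qed.

Let bd : decreasing_terms b.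
Proof.
move=> n n0; rewrite /b /=; apply: decreasing_le => //; last exact/ltnW/sparse_index_lt.
by rewrite /sparse_index addn_gt0 n0 orbT.
Qed.

Lemma sparse_summable : summable_terms b.
Proof.
apply: (summable_comparison a0 asum b0) => n n0.
by rewrite /b /=; apply: decreasing_le => //; rewrite leq_addl.
Qed.

Let bsum := sparse_summable.

Let sparse_doubling : exists2 sg : R, 1 <= sg &
  forall n, (0 < n)%N -> b n <= sg * b (2 * n)%N.
Proof.
have qD : 0 < q * D by rewrite mulr_gt0.
have h n : (0 < n)%N -> b n <= tau ^+ 2 / (q * D) * b (2 * n)%N.
  move=> n0; have kn := trunc_log_bounds (isT : 1 < 2)%N n0.
  have [h1 _] := sparse_bounds kn.
  have [|_ h2] := @sparse_bounds (trunc_log 2 n).+1 (2 * n)%N.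
    by move: kn => /andP[]; rewrite (expnS _ _.+1) (expnS 2 (trunc_log 2 n)); lia.
  rewrite mulrAC ler_pdivlMr // mulrC.
  apply: le_trans (ltW h2); apply: le_trans (targetS _).
  by rewrite ler_wpM2l // ltW.
exists (tau ^+ 2 / (q * D)) => //.
have h1 := h 1%N isT; have h2 : b (2 * 1)%N <= b 1%N := bd (isT : (0 < 1)%N).
have h3 := b0 (isT : (0 < 2 * 1)%N).
by rewrite -(ler_pM2r h3) mul1r (le_trans h2).
Qed.

Let B k := cantor_length b k 0.

Let B_gt k : target k <= tau ^+ 2 * B k.
Proof.
have [|_ h] := @sparse_bounds k (2 ^ k)%N; first by rewrite leqnn ltn_exp2l /=.
apply: le_trans (ltW h) _; rewrite ler_wpM2l ?exprn_ge0 ?(ltW tau0) //.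
by have := @node_le_cantor_length _ _ b0 bsum k 0; rewrite addn0 expn_gt0; exact.
Qed.

(** The gaps removed at the later steps sum to a geometric series of ratio [2 * q],
    which is less than 1 because [s < 1]. *)
Let B_le k : B k <= (1 - 2 * q)^-1 * target k.
Proof.
have q2' := q2; have q0' := q0.
apply: (cantor_length_le b0 bsum) => [|n]; first by rewrite expn_gt0.
apply: (@le_trans _ _ (target k * \sum_(0 <= i < n) (2 * q) ^+ i)); last first.
  rewrite mulrC ler_wpM2r ?(ltW (target_gt0 k)) // geometric_sum_le //.
  by rewrite mulr_ge0 ?(ltW q0).
rewrite mulr_sumr; apply: ler_sum => i _.
apply: (@le_trans _ _ (\sum_(0 <= l < 2 ^ i) target (k + i))).
  rewrite !big_nat; apply: ler_sum => l /andP[_ li].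
  have [|h _] := @sparse_bounds (k + i) (2 ^ (k + i) + 2 ^ i * 0 + l); last exact: h.
  rewrite muln0 addn0 leq_addr /= expnS mul2n -addnn ltn_add2l.
  by apply: leq_trans li _; rewrite leq_exp2l // leq_addl.
rewrite sumr_const_nat subn0 -[leLHS]mulr_natl natrX exprMn [leRHS]mulrCA.
rewrite ler_wpM2l ?exprn_ge0 //.
by rewrite mulrC; exact: targetD.
Qed.

Let B_gt0 k : 0 < B k.
Proof. by apply: cantor_length_gt0 => //; rewrite expn_gt0. Qed.

Let powR_qV n : (q ^- n) `^ s = 2 ^+ n.
Proof.
rewrite -exprVn /q -powRN opprK -!powR_mulrn ?powR_ge0 //.
by rewrite -!powRrM; congr (_ `^ _); field; exact: lt0r_neq0.
Qed.

Let ratio : R := (1 - 2 * q) / tau ^+ 2.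

Let ratio_gt0 : 0 < ratio.
Proof. by rewrite divr_gt0 ?exprn_gt0 // subr_gt0. Qed.

Let sparse_growth : cantor_growth b s.
Proof.
have q2' := q2.
exists (ratio `^ s)^-1, 0%N; split; first by rewrite invr_gt0 powR_gt0.
move=> k n _; rewrite ler_pdivlMl ?powR_gt0 // -powR_qV.
rewrite -powRM; last 2 first.
- exact: ltW.
- by rewrite invr_ge0 exprn_ge0 // ltW.
apply: ge0_ler_powR; rewrite ?nnegrE ?(ltW s0) //.
- by rewrite mulr_ge0 ?invr_ge0 ?exprn_ge0 ?(ltW q0) ?(ltW ratio_gt0).
- by rewrite divr_ge0 // ltW // B_gt0.
rewrite -/(B k) -/(B (k + n)) ler_pdivlMr // mulrAC ler_pdivrMr ?exprn_gt0 //.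
rewrite /ratio mulrAC ler_pdivrMr ?exprn_gt0 //.
apply: (@le_trans _ _ (target (k + n))).
  by rewrite -ler_pdivlMl ?subr_gt0 // B_le.
apply: le_trans (targetD _ _) _.
rewrite (_ : B k * _ * _ = q ^+ n * (tau ^+ 2 * B k)); last by ring.
by rewrite ler_wpM2l ?exprn_ge0 ?(ltW q0).
Qed.

Let sparse_growth_ge al : 0 <= al -> cantor_growth b al -> s <= al.
Proof.
move=> al0 [C [k0 [C0 H]]]; rewrite -[s]mul1r -ler_pdivlMr //.
apply: (@unbounded_power_comparison _ (C * (ratio^-1) `^ al)) => N.
pose p := (2 * maxn k0 N).+1.
have op : odd p by rewrite /p /= oddM.
have pp : (p < 2 ^ p)%N by exact: ltn_expl.
have k0p : (k0 <= 2 ^ p)%N by have := leq_maxl k0 N; rewrite /p in pp *; lia.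
(* The steps from 2^p to 2^(p+1) form a slow block. *)
exists (2 ^ p)%N; first by have := leq_maxr k0 N; rewrite /p in pp *; lia.
apply: le_trans (H _ (2 ^ p)%N k0p) _; rewrite -/(B _) -/(B (_ + _)).
rewrite -mulrA ler_wpM2l ?(ltW C0) // -powR_qV -powRrM mulrCA divff ?gt_eqF // mulr1.
rewrite -powRM; last 2 first.
- by rewrite invr_ge0 ltW.
- by rewrite invr_ge0 exprn_ge0 // ltW.
apply: ge0_ler_powR => //; rewrite ?nnegrE.
- by rewrite divr_ge0 // ltW // B_gt0.
- by rewrite mulr_ge0 ?invr_ge0 ?exprn_ge0 ?(ltW q0) ?(ltW ratio_gt0).
set k := (2 ^ p)%N; rewrite ler_pdivrMr //.
have q2' : 0 < 1 - 2 * q by rewrite subr_gt0.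
have tp := target_plateau op (leqnn (2 ^ p)); rewrite -/k in tp.
have h1 := B_le k; have h2 := B_gt (k + k); rewrite tp in h2.
have qk : 0 < q ^+ k by rewrite exprn_gt0.
apply: le_trans h1 _; rewrite /ratio invf_div.
rewrite [_ / (1 - _)]mulrC -!mulrA ler_wpM2l ?invr_ge0 ?(ltW q2') //.
rewrite [leRHS](_ : _ = tau ^+ 2 * B (k + k) / q ^+ k); last by ring.
by rewrite ler_pdivlMr // mulrC.
Qed.

(** Every step shrinks the target by at least the factor [q], which makes [s] an
    exponent; the slow blocks shrink it by exactly [q] per step over arbitrarily
    long ranges, which excludes smaller exponents. *)
Lemma sparse_exponents al :
  assouad_exponent (cantor_set b) al <-> s <= al.
Proof.
have [sg sg1 bsg] := sparse_doubling; split=> [bal|sal].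
  have bC := complementary_cantor_set b0 bsum.
  apply: sparse_growth_ge; last exact: (cantor_growth_of_exponent b0 bd bsum sg1 bsg bC bal).
  apply: assouad_exponent_ge0 bal; rewrite (cantor_setE b0 bsum).
  exists (cantor_gap_left b 1).
  exact: (gap_left_in_complement b0 (cantor_gap_system b0 bsum)).
apply: assouad_exponent_le sal _.
exact: (assouad_exponent_cantor_set b0 bd bsum sg1 bsg (ltW s0) sparse_growth).
Qed.

End Decay.
End Sparse.

(** * Attained dimensions *)

Section Attained.
Context {R : realType}.
Implicit Types (a : nat -> R) (E F : set R) (al s tau : R).

Lemma doubling_constant a : positive_terms a -> decreasing_terms a ->
  doubling_terms a -> exists2 tau : R, 1 <= tau &
    forall n, (0 < n)%N -> a n <= tau * a (2 * n)%N.
Proof.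
move=> a0 ad [tau taua]; exists tau => //.
have h1 := taua 1%N isT; have h2 : a 2%N <= a 1%N := ad 1%N isT.
have h3 := a0 2%N isT.
by rewrite -(ler_pM2r h3) mul1r (le_trans h2).
Qed.

Lemma complementary_set_neq0 a E : positive_terms a ->
  complementary_set a E -> E !=set0.
Proof.
move=> a0 /(complementary_setP _ a0) [u [gs ->]]; exists (u 1%N).
exact: (gap_left_in_complement a0 gs).
Qed.

Lemma assouad_dim_ge0 F : F !=set0 -> (0 <= assouad_dim F)%E.
Proof.
move=> F0; apply: le_ereal_inf_tmp => _ [al Fal <-].
by rewrite lee_fin; exact: assouad_exponent_ge0 Fal.
Qed.

Lemma assouad_dim_le1 F : (assouad_dim F <= 1%:E)%E.
Proof. by apply: ereal_inf_lbound; exists 1 => //; exact: assouad_exponent1. Qed.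

Lemma assouad_dimE F s : assouad_exponent F s ->
  (forall al, assouad_exponent F al -> s <= al) -> assouad_dim F = s%:E.
Proof.
move=> Fs sF; apply: le_anti; apply/andP; split.
  by apply: ereal_inf_lbound; exists s.
by apply: le_ereal_inf_tmp => _ [al /sF sal <-]; rewrite lee_fin.
Qed.

Section Doubling.
Variables (a : nat -> R) (tau : R).
Hypotheses (a0 : positive_terms a) (ad : decreasing_terms a).
Hypotheses (asum : summable_terms a) (tau1 : 1 <= tau).
Hypothesis taua : forall n, (0 < n)%N -> a n <= tau * a (2 * n)%N.

Lemma assouad_dim_cantor_set_le E :
  complementary_set a E -> (assouad_dim (cantor_set a) <= assouad_dim E)%E.
Proof.
move=> aE; apply: ereal_inf_le_tmp => _ [al Eal <-]; exists al => //.
apply: (assouad_exponent_cantor_set a0 ad asum tau1 taua).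
  exact: assouad_exponent_ge0 (complementary_set_neq0 a0 aE) Eal.
exact: (cantor_growth_of_exponent a0 ad asum tau1 taua aE).
Qed.

Lemma dimension_one_attained :
  exists2 E, complementary_set a E & assouad_dim E = 1%:E.
Proof.
exists (gap_complement a (fun j => tail_sum a j.+1) (total_length a)).
  apply/(complementary_setP _ a0); exists (fun j => tail_sum a j.+1).
  by split=> //; exact: decreasing_gap_system.
apply: assouad_dimE; first exact: assouad_exponent1.
by move=> al; exact: (decreasing_set_exponent a0 ad asum tau1 taua).
Qed.

(** The sparse subsequence forces the exponents to be at least [s]; the remaining
    terms form a sequence [b' n] between [a n / tau] and [a n], whose Cantor set
    keeps the exponent [s]. *)
Lemma intermediate_dimension_attained s : 0 < s -> s < 1 ->
  assouad_exponent (cantor_set a) s ->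
  exists2 E, complementary_set a E & assouad_dim E = s%:E.
Proof.
move=> s0 s1 Cs.
pose sg := @sparse_index R a tau s a0 ad asum tau1 taua.
have sg_ge n : (0 < n)%N -> (2 * n <= sg n)%N by exact: sparse_index_ge.
have sg_inj : positive_inj sg by exact: sparse_index_inj.
have [sg' [sp [sg'_bd sg'_mono]]] := complement_enumeration sg_ge sg_inj.
have sg'_gt0 n : (0 < n)%N -> (0 < sg' n)%N by case: sp => h _ _ _ _ /h [].
have b0 : positive_terms (a \o sg').
  by move=> n n0; apply: a0; exact: sg'_gt0.
have bd : decreasing_terms (a \o sg').
  by move=> n n0; apply: (@decreasing_le _ a) => //=; [exact: sg'_gt0 | exact: sg'_mono].
have ba n : (0 < n)%N -> (a \o sg') n <= a n /\ a n <= tau * (a \o sg') n.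
  move=> n0; have /andP[h1 h2] := sg'_bd n.
  split; first exact: (@decreasing_le _ a).
  apply: le_trans (taua n0) _; rewrite ler_wpM2l ?(le_trans ler01) //=.
  by apply: (@decreasing_le _ a) => //; exact: sg'_gt0.
have bsum : summable_terms (a \o sg').
  by apply: (summable_comparison a0 asum b0) => n /ba [].
have [sg1 sg11 bsg] : exists2 c : R, 1 <= c &
    forall n, (0 < n)%N -> (a \o sg') n <= c * (a \o sg') (2 * n)%N.
  apply: doubling_constant => //; exists (tau * tau) => n n0.
  have [h1 _] := ba n n0; have [|_ h2] := ba (2 * n)%N; first by rewrite muln_gt0.
  apply: le_trans h1 (le_trans (taua n0) _); rewrite -mulrA.
  by rewrite ler_wpM2l // (le_trans ler01).
have ssum : summable_terms (a \o sg) by exact: sparse_summable.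
have sE al : assouad_exponent (cantor_set (a \o sg)) al <-> s <= al.
  exact: sparse_exponents.
have s0' : positive_terms (a \o sg).
  by move=> n n0; apply: a0; case: sp => /(_ n n0) [].
have [E [aE E1 E2]] := complementary_set_concatenation a0 asum sp ssum bsum
  (complementary_cantor_set s0' ssum) (complementary_cantor_set b0 bsum).
exists E => //; apply: assouad_dimE; last first.
  by move=> al /(assouad_exponent_subset E1) /sE.
apply: (assouad_exponent_subset E2); apply: assouad_exponent_setU; first exact/sE.
apply: assouad_exponent_translate.
apply: (assouad_exponent_cantor_set b0 bd bsum sg11 bsg (ltW s0)).
apply: (cantor_growth_comparison a0 asum b0 bsum tau1 ba (ltW s0)).
apply: (cantor_growth_of_exponent a0 ad asum tau1 taua _ Cs).
exact: complementary_cantor_set.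
Qed.

End Doubling.
End Attained.

Theorem corollary11 (R : realType) (a : nat -> R)
    (a_pos : positive_terms a) (a_decr : decreasing_terms a)
    (a_sum : summable_terms a) (a_doubling : doubling_terms a) :
  [set assouad_dim E | E in [set E : set R | complementary_set a E]] =
  `[assouad_dim (cantor_set a), 1%:E]%classic.
Proof.
have [tau tau1 taua] := doubling_constant a_pos a_decr a_doubling.
have aC := complementary_cantor_set a_pos a_sum.
apply/seteqP; split=> [_ [E /= aE <-]|y]; rewrite /= in_itv /=.
  rewrite assouad_dim_le1 andbT.
  exact: (assouad_dim_cantor_set_le a_pos a_decr a_sum tau1 taua).
move=> /andP[]; rewrite le_eqVlt => /orP[/eqP <- _|dy]; first by exists (cantor_set a).
rewrite le_eqVlt => /orP[/eqP ->|].
  have [E aE E1] := dimension_one_attained a_pos a_decr a_sum tau1 taua.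
  by exists E.
have d0 := assouad_dim_ge0 (complementary_set_neq0 a_pos aC).
have := le_lt_trans d0 dy; case: y dy => [s| |] dy //; rewrite !lte_fin => s0 s1.
have [_ [al Cal <-]] := ereal_inf_lt dy; rewrite lte_fin => als.
have Cs := assouad_exponent_le (ltW als) Cal.
have [E aE Es] :=
  intermediate_dimension_attained a_pos a_decr a_sum tau1 taua s0 s1 Cs.
by exists E.
Qed.
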